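(* Let $n\in\mathbb{N}$, let $G:\mathbb{R}\to\mathbb{R}$ be an even function satisfying the regularity assumptions in the context, let $m\in\mathcal{X}$ and define $u:\mathbb{R}^+\to H^n(\mathbb{R})$ by $u(t)=G*(m(t))$. Then $u\in C_b(\mathbb{R}^+;H^n(\mathbb{R}))$. Moreover, if $m$ is $d$-Lipschitz then $u\in C_b^{0,\frac12}(\mathbb{R}^+;H^n(\mathbb{R}))$.
   Context: Assumptions on $G$: $G:\mathbb{R}\to\mathbb{R}$ is even, the classical derivative $G^{(k)}$ of order $k$ is defined everywhere, absolutely continuous and integrable on $\mathbb{R}$ for $0\leqslant k<n$, and there exists $F\in BV(\mathbb{R})$ (an integrable function of bounded variation) that agrees with $G^{(n)}$ almost everywhere on $\mathbb{R}$. $\mathbb{R}^+=[0,\infty)$. $C_0(\mathbb{R})$ is the space of continuous real functions on $\mathbb{R}$ vanishing at infinity, with the supremum norm $\|\cdot\|_\infty$. $\mathcal{M}(\mathbb{R})$ is the space of finite signed Radon measures on $\mathbb{R}$, and $B_{\mathcal{M}^+(\mathbb{R})}$ is the set of positive measures of total variation at most $1$. $(G*\mu)(x)=\int_{\mathbb{R}} G(x-y)\,d\mu(y)$ for $\mu\in\mathcal{M}(\mathbb{R})$; this equals $T^*\mu$, where $T^*:\mathcal{M}(\mathbb{R})\to H^n(\mathbb{R})$ is the dual of the bounded operator $T:H^n(\mathbb{R})\to C_0(\mathbb{R})$, $(Tu)(x)=\sum_{k=0}^n(-1)^k(G^{(k)}*u^{(k)})(x)$ ($H^n(\mathbb{R})$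 being identified with its dual). $\|\mu\|_{BL}=\sup\{\int f\,d\mu: f\in C_0(\mathbb{R}),\ \|f\|_\infty+\mathrm{Lip}(f)\leqslant 1\}$, where $\mathrm{Lip}(f)$ is the Lipschitz constant, and $d(\mu,\nu)=\|\mu-\nu\|_{BL}$. $\mathcal{X}$ is the set of all $d$-continuous maps $m:\mathbb{R}^+\to B_{\mathcal{M}^+(\mathbb{R})}$; $m\in\mathcal{X}$ is $d$-Lipschitz if there is $L>0$ with $d(m(s),m(t))\leqslant L|s-t|$ for all $s,t\in\mathbb{R}^+$. $C_b(\mathbb{R}^+;H^n(\mathbb{R}))$ is the space of bounded continuous functions $\mathbb{R}^+\to H^n(\mathbb{R})$, and $C_b^{0,\frac12}(\mathbb{R}^+;H^n(\mathbb{R}))$ is the space of $\frac12$-H\''older continuous functions $u:\mathbb{R}^+\to H^n(\mathbb{R})$ that are bounded, i.e. $\sup_{t\in\mathbb{R}^+}\|u(t)\|<\infty$ in the $H^n(\mathbb{R})$-norm. *)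

(* Defs.v *)
From HB Require Import structures.
From mathcomp Require Import all_boot all_order all_algebra.
From mathcomp Require Import all_classical all_reals all_analysis.

Set Implicit Arguments.
Unset Strict Implicit.
Unset Printing Implicit Defensive.

Import Order.TTheory GRing.Theory Num.Theory.
Import numFieldNormedType.Exports.

Local Open Scope ring_scope.
Local Open Scope classical_set_scope.

Section regularity_of_the_kernel.
Context {R : realType}.
Local Notation mu := (@lebesgue_measure R).

(* The iterates [f^`(j)] are total, with an arbitrary value where the
   derivative does not exist; this says that the classical derivative of order
   [k] really exists at [x]. *)
Definition derivable_n (k : nat) (f : R -> R) (x : R) : Prop :=
  forall j, (j < k)%N -> derivable f^`(j) x 1.

Definition absolutely_continuous_on_R (f : R -> R) : Prop :=
  forall e : R, 0 < e -> exists2 d : R, 0 < d &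
    forall (N : nat) (a b : 'I_N -> R),
      (forall i, a i <= b i) ->
      trivIset setT (fun i => `]a i, b i[%classic) ->
      \sum_(i < N) (b i - a i) < d ->
      \sum_(i < N) `|f (b i) - f (a i)| < e.

Definition integrable_on_R (f : R -> R) : Prop :=
  mu.-integrable setT (EFin \o f).

Definition BV (f : R -> R) : Prop :=
  integrable_on_R f /\
  exists M : R, forall a b, a <= b -> (total_variation a b f <= M%:E)%E.

Definition even_fun (f : R -> R) : Prop := forall x, f (- x) = f x.

Definition regular_kernel (n : nat) (G : R -> R) : Prop :=
  (forall k, (k < n)%N ->
     [/\ forall x, derivable_n k G x,
         absolutely_continuous_on_R G^`(k) &
         integrable_on_R G^`(k)]) /\
  exists2 F : R -> R, BV F &
    {ae mu, forall x, derivable_n n G x /\ G^`(n) x = F x}.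

End regularity_of_the_kernel.

Section bounded_lipschitz_norm.
Context {R : realType}.
Local Notation T := (measurableTypeR R).
Implicit Types (f : R -> R) (nu : {charge set T -> \bar R}).

(* A finite signed Borel measure on the real line is automatically Radon, so
   the finite signed Radon measures are exactly the charges on [T]. *)

Lemma hahn_ex nu : exists PN : set T * set T,
  hahn_decomposition nu PN.1 PN.2.
Proof. by have [P [N PN]] := Hahn_decomposition nu; exists (P, N). Qed.

Definition charge_integral nu f : R :=
  let PN := projT2 (cid (hahn_ex nu)) in
  \int[jordan_pos PN]_x f x - \int[jordan_neg PN]_x f x.

Definition C0 f : Prop :=
  [/\ continuous f, f x @[x --> +oo] --> 0 & f x @[x --> -oo] --> 0].

Definition sup_norm f : \bar R := ereal_sup [set `|f x|%:E | x in setT].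

Definition Lip f : \bar R :=
  ereal_sup [set (`|f p.1 - f p.2| / `|p.1 - p.2|)%:E
            | p in [set p : R * R | p.1 != p.2]].

Definition BL_norm nu : \bar R :=
  ereal_sup [set (charge_integral nu f)%:E
            | f in [set f | C0 f /\ (sup_norm f + Lip f <= 1)%E]].

(* [subprobability T R] is the type of positive measures of total mass, hence
   of total variation, at most 1. *)
Definition BL_dist (m1 m2 : subprobability T R) : \bar R :=
  BL_norm (cadd (charge_of_finite_measure m1)
                (copp (charge_of_finite_measure m2))).

End bounded_lipschitz_norm.

Section curves.
Context {R : realType}.

Definition Rplus : set R := [set t | 0 <= t].

(* Functions on [0, +oo) are represented by functions on [R] whose values at
   negative times are never used. *)
Definition BL_continuous (m : R -> subprobability (measurableTypeR R) R) :
    Prop :=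
  forall t, Rplus t ->
    BL_dist (m s) (m t) @[s --> within Rplus (nbhs t)] --> 0%E.

Definition BL_lipschitz (m : R -> subprobability (measurableTypeR R) R) :
    Prop :=
  exists2 L : R, 0 < L &
    forall s t, Rplus s -> Rplus t ->
      (BL_dist (m s) (m t) <= (L * `|s - t|)%:E)%E.

Definition conv_measure (G : R -> R)
    (m : {measure set (measurableTypeR R) -> \bar R}) : R -> R :=
  fun x => \int[m]_y G (x - y).

End curves.

Section sobolev.
Context {R : realType}.
Local Notation mu := (@lebesgue_measure R).

Definition test_function (phi : R -> R) : Prop :=
  (forall k x, derivable phi^`(k) x 1) /\
  compact (closure [set x | phi x != 0]).

Definition weak_derivative (k : nat) (f g : R -> R) : Prop :=
  forall phi, test_function phi ->
    \int[mu]_x (f x * (phi^`(k))%classic x) = (-1) ^+ k * \int[mu]_x (g x * phi x).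

(* Elements of H^n(R) are classes of functions modulo a.e. equality and are
   represented here by functions: [w 0] is a square integrable Borel
   representative of the class of [f], and [w k] represents its weak derivative
   of order [k]. *)
Definition weak_derivatives (n : nat) (f : R -> R) (w : nat -> R -> R) : Prop :=
  f = w 0%N %[ae mu] /\
  forall k, (k <= n)%N ->
    w k \in Lfun mu 2%:E /\ weak_derivative k (w 0%N) (w k).

Definition Hn (n : nat) (f : R -> R) : Prop :=
  exists w, weak_derivatives n f w.

(* Weak derivatives are unique up to a.e. equality, so that the choice made
   here does not affect [Hn_norm]; only meaningful when [Hn n f]. *)
Definition weak_der (n : nat) (f : R -> R) : nat -> R -> R :=
  xget (fun _ _ => 0) [set w | weak_derivatives n f w].

Definition Hn_norm (n : nat) (f : R -> R) : R :=
  Num.sqrt (\sum_(k < n.+1) \int[mu]_x (weak_der n f k x ^+ 2)).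

Definition Hn_bounded (n : nat) (u : R -> R -> R) : Prop :=
  exists M : R, forall t, Rplus t -> Hn_norm n (u t) <= M.

Definition Cb_Hn (n : nat) (u : R -> R -> R) : Prop :=
  [/\ forall t, Rplus t -> Hn n (u t),
      forall t, Rplus t ->
        Hn_norm n (u s \- u t) @[s --> within Rplus (nbhs t)] --> 0 &
      Hn_bounded n u].

Definition Cb_holder_half_Hn (n : nat) (u : R -> R -> R) : Prop :=
  [/\ forall t, Rplus t -> Hn n (u t),
      exists C : R, forall s t, Rplus s -> Rplus t ->
        Hn_norm n (u s \- u t) <= C * `|s - t| `^ 2^-1 &
      Hn_bounded n u].

End sobolev.

(* Main.v *)
(** Write [F_k] for [G^(k)] when [k < n] and for [F] when [k = n].  The weak
derivatives of [G * m] are the [F_k * m], so it suffices to bound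
[v = F_k * m1 - F_k * m2] in [L^2].  By Fubini, [int v^2 = int g d(m1 - m2)]
where [g y = int F_k (x - y) v x dx].  The kernel [F_k] is bounded and
integrable, and its translations are Lipschitz in the parameter: uniformly if
[k < n], since an absolutely continuous function with a bounded derivative is
Lipschitz, and in [L^1] if [k = n], since [F] has bounded variation.  Hence [g]
is bounded and Lipschitz, with constants independent of [m1] and [m2], and
integrable, so that it vanishes at infinity: up to a constant factor it is
admissible in the supremum defining the distance, and [int v^2] is at most
a constant times [d m1 m2].  As the distance controls the square of the norm,
Lipschitz curves of measures are sent to curves of Hoelder exponent 1/2. *)

Require Import Defs.
From mathcomp Require Import all_boot all_order all_algebra.
From mathcomp Require Import all_classical all_reals all_analysis.
From mathcomp Require Import measurable_realfun ring lra.

Set Implicit Arguments.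
Unset Strict Implicit.
Unset Printing Implicit Defensive.

Import Order.TTheory GRing.Theory Num.Theory.
Import numFieldNormedType.Exports.

Local Open Scope ring_scope.
Local Open Scope classical_set_scope.

(** * Smooth functions *)

Section smooth_functions.
Context {R : realType}.
Implicit Types (f g : R -> R) (x : R).

(** [Hn_norm] is computed from weak derivatives obtained by choice, so nothing can be said of it
    before they are known to be unique almost everywhere. This is why concrete test functions are
    needed: smoothed indicators of intervals, built from exp(-1/x), on which the fundamental lemma
    of the calculus of variations rests. No bound on the derivatives of the kernel is given. They
    are obtained from the top order downwards: [F] is bounded, so the derivative below it is
    Lipschitz; being also integrable it is bounded, and the argument repeats. The function [g]
    depends on both measures through [v]. Its constants are nevertheless uniform, because masses at
    most 1 bound [v] and its L^1 norm by twice the corresponding norms of the kernel. When [n = 0],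
    the kernel [G] is known only up to a null set and may fail to be measurable; [conv_measure G m]
    is then compared with the convolution of [F] by means of lower integrals. *)

Definition smooth f := forall k x, derivable f^`(k) x 1.

Lemma smooth_derive1 f : smooth f -> smooth f^`().
Proof. by move=> sf k x; rewrite -derive1Sn; exact: sf. Qed.

(** A coinduction principle: smoothness is obtained by exhibiting a class of derivable functions
    closed under derivation, without computing any iterated derivative. *)
Lemma smooth_of_stable (S : set (R -> R)) :
  (forall f, S f -> (forall x, derivable f x 1) /\ S f^`()) ->
  forall f, S f -> smooth f.
Proof.
move=> SP f Sf k; elim: k f Sf => [|k IH] f /SP[df Sf'] x; first exact: df.
by rewrite derive1Sn; exact: IH.
Qed.

(* Finite sums of products of smooth functions are stable under derivation,
   which makes Leibniz' formula unnecessary. *)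
Inductive sum_of_products : (R -> R) -> Prop :=
| sum_of_products_mul f g : smooth f -> smooth g -> sum_of_products (f \* g)
| sum_of_products_add f g : sum_of_products f -> sum_of_products g ->
    sum_of_products (f \+ g).

Lemma smoothM f g : smooth f -> smooth g -> smooth (f \* g).
Proof.
move=> sf sg; apply: (@smooth_of_stable sum_of_products); last first.
  exact: sum_of_products_mul.
move=> h; elim=> {f g sf sg h} f g.
- move=> sf sg; split=> [x|].
    by apply: derivableM; [exact: (sf 0%N)|exact: (sg 0%N)].
  have -> : (f \* g)^`() = (f \* g^`()) \+ (g \* f^`()).
    apply/funext => x; rewrite derive1E deriveM; last 2 first.
    - exact: (sf 0%N).
    - exact: (sg 0%N).
    by rewrite /= !derive1E.
  apply: sum_of_products_add.
    exact: (sum_of_products_mul sf (smooth_derive1 sg)).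
  exact: (sum_of_products_mul sg (smooth_derive1 sf)).
- move=> _ [df Sf'] _ [dg Sg']; split=> [x|]; first exact: (derivableD (df x) (dg x)).
  have -> : (f \+ g)^`() = f^`() \+ g^`().
    by apply/funext => x; rewrite derive1E (deriveD (df x) (dg x)) /= !derive1E.
  exact: sum_of_products_add.
Qed.

Lemma is_derive1_comp f g x df dg : is_derive x 1 g dg ->
  is_derive (g x) 1 f df -> is_derive x 1 (fun y => f (g y)) (df * dg).
Proof.
move=> [gx <-] [fx <-]; apply: DeriveDef.
  move: gx fx => /derivable1_diffP gx /derivable1_diffP fx.
  exact: (iffRL (derivable1_diffP _ _) (differentiable_comp gx fx)).
by have := derive1_comp gx fx; rewrite !derive1E.
Qed.

Lemma is_derive_affine f a b x df : is_derive (a * x + b) 1 f df ->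
  is_derive x 1 (fun y => f (a * y + b)) (a * df).
Proof.
have dab : is_derive x 1 (fun y => a * y + b) a.
  by apply: is_derive_eq; rewrite addr0 /GRing.scale/= mulr1.
by move=> fdf; rewrite mulrC; exact: (is_derive1_comp dab fdf).
Qed.

Lemma derive1_affine f a b x : derivable f (a * x + b) 1 ->
  (fun y => f (a * y + b))^`() x = a * f^`()%classic (a * x + b).
Proof.
by move=> /derivableP/is_derive_affine [_]; rewrite !derive1E => ->.
Qed.

Lemma derivable_affine f a b x : derivable f (a * x + b) 1 ->
  derivable (fun y => f (a * y + b)) x 1.
Proof. by move=> /derivableP/is_derive_affine []. Qed.

Lemma derive1n_affine f a b k : (forall j x, (j < k)%N -> derivable f^`(j) x 1) ->
  (fun y => f (a * y + b))^`(k) = fun y => a ^+ k * f^`(k)%classic (a * y + b).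
Proof.
elim: k => [|k IH] df; first by apply/funext => y; rewrite expr0 mul1r.
rewrite derive1nS IH; last by move=> j x jk; apply: df; exact: ltnW.
apply/funext => x; rewrite derive1E.
rewrite (_ : (fun y => _) = a ^+ k *: (fun y => f^`(k)%classic (a * y + b)))//.
rewrite deriveZ; last by apply: derivable_affine; exact: df.
rewrite -derive1E derive1_affine; last exact: df.
by rewrite derive1nS exprSr -mulrA.
Qed.

Lemma smooth_affine f a b : smooth f -> smooth (fun x => f (a * x + b)).
Proof.
move=> sf k x; rewrite derive1n_affine//.
apply: (@derivableZ _ _ _ (fun y => f^`(k) (a * y + b))).
by apply: derivable_affine; exact: sf.
Qed.

(** The difference quotient at [x] is at most [C * |h|]. This is what glues the two halves of
    [exp_germ] at the origin. *)
Lemma is_derive_quadratic f x C : f x = 0 ->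
  (forall y, `|f y| <= C * (y - x) ^+ 2) -> is_derive x 1 f 0.
Proof.
move=> fx fC.
have C0 : 0 <= C.
  have := fC (x + 1); rewrite (addrC x) addrK expr1n mulr1.
  exact: le_trans.
have cv : h^-1 *: ((f \o shift x) (h *: 1) - f x) @[h --> 0^'] --> (0 : R).
  apply/cvgr0Pnorm_lt => e e0; near=> h.
  have h0 : h != 0 by near: h; exact: nbhs_dnbhs_neq.
  rewrite fx subr0 normrZ normfV /=.
  rewrite mulrC ltr_pdivrMr ?normr_gt0//.
  apply: le_lt_trans (fC _) _; rewrite -real_normK ?num_real//.
  rewrite [h *: 1](_ : _ = h); last by rewrite /GRing.scale/= mulr1.
  rewrite addrK expr2 mulrA ltr_pM2r ?normr_gt0//.
  apply: (@le_lt_trans _ _ ((C + 1) * `|h|)).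
    by rewrite ler_wpM2r// lerDl.
  rewrite mulrC -ltr_pdivlMr ?ltr_wpDl//.
  near: h; apply: dnbhs0_lt; rewrite divr_gt0// ltr_wpDl//.
by apply: DeriveDef; [exact: cvgP cv|exact: cvg_lim cv].
Unshelve. all: by end_near. Qed.

(** The polynomial factor in 1/x makes the family closed under derivation; [p = 1] is the classical
    smooth function exp(-1/x), extended by 0. *)
Definition exp_germ (p : {poly R}) x : R :=
  if 0 < x then p.[x^-1] * expR (- x^-1) else 0.

(** The exponential series gives t^i <= i! e^t, hence t^i <= (i+1)! e^t, for each monomial. *)
Lemma poly_expRN_bounded (p : {poly R}) : exists2 C : R, 0 <= C &
  forall t, 0 < t -> `|p.[t] * expR (- t)| <= C.
Proof.
exists (\sum_(i < size p) `|p`_i| * (i.+1)`!%:R).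
  by apply: sumr_ge0 => i _; rewrite mulr_ge0.
move=> t t0; rewrite horner_coef mulr_suml.
apply: le_trans (ler_norm_sum _ _ _) _; apply: ler_sum => i _.
rewrite -mulrA normrM ler_wpM2l// normrM normrX.
rewrite (ger0_norm (expR_ge0 _)) (gtr0_norm t0) expRN.
rewrite ler_pdivrMr ?expR_gt0//.
case: i => -[|i] /= _.
  by rewrite expr0 mul1r (le_trans _ (expR_ge1Dx t))// lerDl ltW.
have := expR_ge1Dxn i (ltW t0) => h.
have h2 : t ^+ i.+1 / i.+1`!%:R <= expR t.
  by apply: le_trans h; rewrite lerDr.
rewrite ler_pdivrMr ?ltr0n ?fact_gt0// in h2.
apply: le_trans h2 _; rewrite mulrC ler_wpM2r ?expR_ge0//.
by rewrite ler_nat [leqRHS]factS leq_pmull.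
Qed.

(** The previous bound is applied to [p * 'X^2] at t = 1/x, the extra factor t^2 providing the
    x^2. *)
Lemma exp_germ_quadratic p : exists C : R,
  forall x, `|exp_germ p x| <= C * x ^+ 2.
Proof.
have [C C0 pC] := poly_expRN_bounded (p * 'X^2).
exists C => x; rewrite /exp_germ; case: ifPn => [x0|_]; last first.
  by rewrite normr0 mulr_ge0// sqr_ge0.
have := pC x^-1; rewrite invr_gt0 => /(_ x0).
rewrite hornerM hornerXn exprVn mulrAC normrM.
by rewrite normfV (ger0_norm (sqr_ge0 x)) ler_pdivrMr ?exprn_gt0.
Qed.

Lemma is_derive_exp_germ p x :
  is_derive x 1 (exp_germ p) (exp_germ ('X^2 * (p - p^`())) x).
Proof.
have [x0|x0|<-] := ltgtP 0 x.
-
  have dV : is_derive x 1 (fun y => y^-1) (- x ^- 2).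
    apply: DeriveDef; first by apply: derivableV; rewrite ?gt_eqF.
    by rewrite (@deriveV _ _ id) ?gt_eqF// derive_id scaler1.
  have dP : is_derive x 1 (fun y => p.[y^-1]) (p^`().[x^-1] * - x ^- 2).
    exact: (is_derive1_comp dV (is_derive_poly p x^-1)).
  have dE : is_derive x 1 (fun y => expR (- y^-1)) (expR (- x^-1) * x ^- 2).
    have dN : is_derive x 1 (fun y => - y^-1) (x ^- 2).
      by have := is_deriveN dV; rewrite opprK.
    exact: (is_derive1_comp dN (is_derive_expR (- x^-1))).
  have dPE := is_deriveM dP dE.
  have /near_eq_is_derive : \near x, (fun y => p.[y^-1] * expR (- y^-1)) x =
      exp_germ p x.
    by near=> y; rewrite /exp_germ ifT//; near: y; exact: lt_nbhsr.
  move=> /(_ _ _ dPE) germ_p; rewrite (_ : exp_germ _ x =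
    p.[x^-1] * (expR (- x^-1) * x ^- 2) +
    expR (- x^-1) * (p^`().[x^-1] * - x ^- 2)); first exact: germ_p.
  rewrite /exp_germ x0 hornerM hornerXn hornerD hornerN exprVn.
  by rewrite mulrBr mulrBl; ring.
- have /near_eq_is_derive : \near x, cst 0 x = exp_germ p x.
    near=> y; rewrite /exp_germ ifF//; apply/negbTE; rewrite -leNgt ltW//.
    by near: y; exact: lt_nbhsl.
  move=> /(_ _ _ (is_derive_cst _ _ _)) germ_p.
  by rewrite {2}/exp_germ ltNge (ltW x0).
(* At the origin both the function and the claimed derivative are 0, and the quadratic bound holds
   on either side. *)
- rewrite {2}/exp_germ ltxx.
  have [C pC] := exp_germ_quadratic p.
  apply: (@is_derive_quadratic _ _ C); first by rewrite /exp_germ ltxx.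
  by move=> y; rewrite subr0.
Unshelve. all: by end_near. Qed.

Lemma smooth_exp_germ p : smooth (exp_germ p).
Proof.
apply: (@smooth_of_stable (range exp_germ)); last by exists p.
move=> _ [q _ <-]; split=> [x|].
  by have [] := is_derive_exp_germ q x.
exists ('X^2 * (q - q^`())) => //; apply/funext => x.
by have [_] := is_derive_exp_germ q x; rewrite derive1E => ->.
Qed.

End smooth_functions.

(** * Integrals and test functions *)

Section real_integrals.
Context d (T : measurableType d) (R : realType) (m : {measure set T -> \bar R}).
Implicit Types f g h : T -> R.
Local Notation L1 f := (m.-integrable setT (EFin \o f)).

Lemma L1_measurable f : L1 f -> measurable_fun setT f.
Proof. by move=> /measurable_int/measurable_EFinP. Qed.

Lemma L1_le f g : measurable_fun setT f -> (forall x, `|f x| <= g x) ->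
  L1 g -> L1 f.
Proof.
move=> mf fg; apply: le_integrable => //; first exact/measurable_EFinP.
by move=> x _ /=; rewrite lee_fin (le_trans (fg x))// ler_norm.
Qed.

Lemma L1D f g : L1 f -> L1 g -> L1 (fun x => f x + g x).
Proof. by move=> lf lg; exact: (integrableD measurableT lf lg). Qed.

Lemma L1B f g : L1 f -> L1 g -> L1 (fun x => f x - g x).
Proof. by move=> lf lg; exact: (integrableB measurableT lf lg). Qed.

Lemma L1Zl f c : L1 f -> L1 (fun x => c * f x).
Proof. by move=> lf; exact: (integrableZl measurableT c lf). Qed.

Lemma L1_norm f : L1 f -> L1 (fun x => `|f x|).
Proof. exact: integrable_norm. Qed.

Lemma L1_Mbounded f g C : measurable_fun setT f -> (forall x, `|f x| <= C) ->
  L1 g -> L1 (fun x => f x * g x).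
Proof.
move=> mf fC lg; have mg := L1_measurable lg.
apply: (@L1_le _ (fun x => C * `|g x|)); first exact: measurable_funM.
  by move=> x; rewrite normrM ler_wpM2r.
exact/L1Zl/L1_norm.
Qed.

Lemma L1_Msquare f g : measurable_fun setT f -> measurable_fun setT g ->
  L1 (fun x => f x ^+ 2) -> L1 (fun x => g x ^+ 2) -> L1 (fun x => f x * g x).
Proof.
move=> mf mg lf lg.
apply: (@L1_le _ (fun x => f x ^+ 2 + g x ^+ 2)); first exact: measurable_funM.
  move=> x; rewrite -(real_normK (num_real (f x))) -(real_normK (num_real (g x))).
  by rewrite normrM; nra.
exact: L1D.
Qed.

Lemma L1_sqrB f g : measurable_fun setT f -> measurable_fun setT g ->
  L1 (fun x => f x ^+ 2) -> L1 (fun x => g x ^+ 2) ->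
  L1 (fun x => (f x - g x) ^+ 2).
Proof.
move=> mf mg lf lg.
rewrite (_ : (fun x => _) = fun x => (f x ^+ 2 + g x ^+ 2) - 2 * (f x * g x)).
  by apply: L1B; [exact: L1D|apply: L1Zl; exact: L1_Msquare].
by apply/funext => x; ring.
Qed.

Lemma ae_imply (P Q : T -> Prop) : (forall x, P x -> Q x) ->
  {ae m, forall x, P x} -> {ae m, forall x, Q x}.
Proof. by move=> PQ; apply: filterS. Qed.

Lemma ae_and (P Q : T -> Prop) : {ae m, forall x, P x} ->
  {ae m, forall x, Q x} -> {ae m, forall x, P x /\ Q x}.
Proof. by move=> aeP aeQ; near=> x; split; near: x. Unshelve. all: by end_near. Qed.

Lemma L1_indic (A : set T) : measurable A -> (m A < +oo)%E -> L1 (\1_A : T -> R).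
Proof.
move=> mA Afin; apply/integrableP; split; first exact/measurable_EFinP.
under eq_integral do rewrite /= ger0_norm//.
by rewrite integral_indic// setIT.
Qed.

Lemma Rintegral_cvg (f_ : nat -> T -> R) f g :
  (forall n, measurable_fun setT (f_ n)) -> measurable_fun setT f ->
  {ae m, forall x, f_ ^~ x @ \oo --> f x} -> L1 g ->
  (forall n x, `|f_ n x| <= g x) ->
  \int[m]_x f_ n x @[n --> \oo] --> \int[m]_x f x.
Proof.
move=> mf_ mf f_f lg f_g.
have [] := @dominated_convergence _ _ _ m setT measurableT
  (fun n => EFin \o f_ n) (EFin \o f) (EFin \o g).
- by move=> n; exact/measurable_EFinP.
- exact/measurable_EFinP.
- apply: filterS f_f => x /= cfx _; apply/fine_cvgP; split; first exact: nearW.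
  exact: cfx.
- exact: lg.
- by apply: aeW => x n _ /=; rewrite lee_fin.
move=> lf _; rewrite -(fineK (integrable_fin_num _ lf))// => cf.
exact: (fine_cvg cf).
Qed.

End real_integrals.

Section test_functions.
Context {R : realType}.
Local Notation mu := (@lebesgue_measure R).
Local Notation L1 f := (mu.-integrable setT (EFin \o f)).
Implicit Types f g phi w : R -> R.

Lemma smooth_continuous f : smooth f -> continuous f.
Proof.
move=> sf x; apply: differentiable_continuous; apply/derivable1_diffP.
exact: (sf 0%N).
Qed.

Lemma continuous_measurable f : continuous f -> measurable_fun setT f.
Proof. exact: continuous_measurable_fun. Qed.

Lemma compact_dominated_L1 f (K : set R) C : compact K -> measurable_fun setT f ->
  (forall x, `|f x| <= C) -> (forall x, ~ K x -> f x = 0) -> L1 f.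
Proof.
move=> cK mf fC fK; have mK := compact_measurable cK.
apply: (@L1_le _ (measurableTypeR R) _ mu _ (fun x => C * \1_K x)) => //.
  move=> x; rewrite indicE; case: (boolP (x \in K)) => xK; first by rewrite mulr1.
  rewrite mulr0 fK ?normr0//; by move/mem_set; apply/negP.
by apply/L1Zl/L1_indic => //; exact: compact_finite_measure.
Qed.

Lemma test_function_smooth phi : test_function phi -> smooth phi.
Proof. by case. Qed.

Lemma test_function_supp phi :
  test_function phi -> exists2 K : set R, compact K & forall x, ~ K x -> phi x = 0.
Proof.
move=> [_ cK]; exists (closure [set x | phi x != 0]) => // x nKx.
by apply/eqP/negPn/negP => phix; apply: nKx; exact: subset_closure.
Qed.

Lemma smooth_supp_test phi (K : set R) : smooth phi -> compact K ->
  (forall x, ~ K x -> phi x = 0) -> test_function phi.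
Proof.
move=> sphi cK phiK; split => //.
apply: (subclosed_compact _ cK); first exact: closed_closure.
have /closure_id -> : closed K by apply: compact_closed => //; exact: Rhausdorff.
apply: closure_subset => x /=; apply: contra_neqP => /phiK ->//.
Qed.

Lemma test_function_bounded phi : test_function phi ->
  exists C : R, forall x, `|phi x| <= C.
Proof.
move=> tphi; have [K cK phiK] := test_function_supp tphi.
have : compact (phi @` K).
  apply: continuous_compact => //; apply: continuous_subspaceT.
  exact/smooth_continuous/test_function_smooth.
move=> /compact_bounded[M [_ MK]]; exists (`|M| + 1) => x.
have [/phiK ->|/contrapT Kx] := pselect (~ K x).
  by rewrite normr0 addr_ge0.
by apply: MK; [rewrite ltr_pwDr// ler_norm|exists x].
Qed.

Lemma test_function_derive1 phi : test_function phi -> test_function phi^`().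
Proof.
move=> tphi; have [K cK phiK] := test_function_supp tphi.
apply: (smooth_supp_test _ cK); first exact/smooth_derive1/test_function_smooth.
move=> x nKx; rewrite derive1E.
transitivity ('D_1 (cst 0 : R -> R) x); last by rewrite derive_cst.
apply: near_eq_derive; have : nbhs x (~` K).
  apply: open_nbhs_nbhs; split => //.
  by apply: closed_openC; apply: compact_closed => //; exact: Rhausdorff.
by apply: filterS => y nKy; rewrite (phiK y nKy).
Qed.

Lemma test_function_derive1n phi k : test_function phi -> test_function phi^`(k).
Proof. by elim: k => // k IH /IH; exact: test_function_derive1. Qed.

Lemma test_function_shift phi b : test_function phi ->
  test_function (fun x => phi (x + b)).
Proof.
move=> tphi; have [K cK phiK] := test_function_supp tphi.
apply: (@smooth_supp_test _ ((fun x => x - b) @` K)).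
- have := smooth_affine (a := 1) (b := b) (test_function_smooth tphi).
  by under eq_fun do rewrite mul1r.
- apply: continuous_compact => //; apply: continuous_subspaceT => x.
  by apply: cvgB; [exact: cvg_id|exact: cvg_cst].
- move=> x nKx; apply: phiK => Kx; apply: nKx; exists (x + b) => //.
  by rewrite addrK.
Qed.

Lemma test_function_measurable phi : test_function phi -> measurable_fun setT phi.
Proof.
move=> tphi; apply: continuous_measurable; apply: smooth_continuous.
exact: test_function_smooth.
Qed.

Lemma test_function_L1 phi : test_function phi -> L1 phi.
Proof.
move=> tphi; have [K cK phiK] := test_function_supp tphi.
have [C phiC] := test_function_bounded tphi.
by apply: (compact_dominated_L1 cK _ phiC phiK); exact: test_function_measurable.
Qed.

Lemma test_function_sqr_L1 phi : test_function phi -> L1 (fun x => phi x ^+ 2).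
Proof.
move=> tphi; have [C phiC] := test_function_bounded tphi.
have mphi := test_function_measurable tphi.
exact: (@L1_Mbounded _ (measurableTypeR R) _ mu _ _ _ mphi phiC
  (test_function_L1 tphi)).
Qed.

End test_functions.

(** * The fundamental lemma of the calculus of variations *)

Section fundamental_lemma.
Context {R : realType}.
Local Notation mu := (@lebesgue_measure R).
Local Notation L1 f := (mu.-integrable setT (EFin \o f)).
Implicit Types (f g phi w : R -> R) (a b x y : R).

(** Each factor vanishes beyond one endpoint. Dilating by [n.+1] sends exp(-1/((n+1)y)) to 1 for y >
    0, so that these functions converge to the indicator of the open interval while staying below
    it; no normalization is involved. *)
Definition bump a b (n : nat) x : R :=
  exp_germ 1 (n.+1%:R * x + - (n.+1%:R * a)) *
  exp_germ 1 (- n.+1%:R * x + n.+1%:R * b).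

Lemma exp_germ1E x : exp_germ 1 x = if 0 < x then expR (- x^-1) else 0.
Proof. by rewrite /exp_germ hornerC mul1r. Qed.

Lemma exp_germ1_ge0 x : 0 <= exp_germ 1 x.
Proof. by rewrite exp_germ1E; case: ifP => // _; exact: expR_ge0. Qed.

Lemma exp_germ1_le1 x : exp_germ 1 x <= 1.
Proof.
rewrite exp_germ1E; case: ifP => // x0.
by rewrite -expR0 ler_expR oppr_le0 invr_ge0 ltW.
Qed.

Lemma bump_ge0 a b n x : 0 <= bump a b n x.
Proof. by rewrite mulr_ge0// exp_germ1_ge0. Qed.

Lemma bump_le1 a b n x : bump a b n x <= 1.
Proof. by rewrite mulr_ile1// ?exp_germ1_ge0// exp_germ1_le1. Qed.

Lemma bump_out a b n x : x \notin `]a, b[%R -> bump a b n x = 0.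
Proof.
rewrite in_itv/= negb_and -!leNgt /bump !exp_germ1E => /orP[xa|bx].
  rewrite [X in X * _]ifF ?mul0r//; apply/negbTE; rewrite -leNgt.
  by rewrite -mulrBr pmulr_rle0 ?ltr0n// subr_le0.
rewrite [X in _ * X]ifF ?mulr0//; apply/negbTE; rewrite -leNgt.
by rewrite mulNr addrC -mulrBr pmulr_rle0 ?ltr0n// subr_le0.
Qed.

Lemma test_function_bump a b n : test_function (bump a b n).
Proof.
apply: (@smooth_supp_test _ _ `[a, b]).
- apply: smoothM; [apply: (@smooth_affine _ (exp_germ 1))|
    apply: (@smooth_affine _ (exp_germ 1))]; exact: smooth_exp_germ.
- exact: segment_compact.
- move=> x /= nx; apply: bump_out; apply/negP => xab; apply: nx.
  exact: subset_itv_oo_cc xab.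
Qed.

Lemma exp_germ1_scale_cvg y : 0 < y ->
  exp_germ 1 (n.+1%:R * y) @[n --> \oo] --> (1 : R).
Proof.
move=> y0.
have -> : (fun n => exp_germ 1 (n.+1%:R * y)) =
    (fun n : nat => expR (- (harmonic n * y^-1))).
  by apply/funext => n; rewrite exp_germ1E mulr_gt0// invfM.
have h0 : (- (harmonic n * y^-1) : R) @[n --> \oo] --> (0 : R).
  have := cvgN (cvgMr_tmp (b := y^-1) (@cvg_harmonic R)).
  by rewrite mul0r oppr0; exact.
rewrite -(@expR0 R); apply: (cvg_comp _ _ h0); exact: continuous_expR.
Qed.

Lemma bump_cvg a b x : bump a b n x @[n --> \oo] --> (\1_`]a, b[ x : R).
Proof.
rewrite indicE; case: (boolP (x \in _)) => xab; last first.
  rewrite (_ : (fun n => _) = cst 0); first exact: cvg_cst.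
  apply/funext => n; apply: bump_out; apply: contra xab.
  by move=> xab; rewrite inE.
move: xab; rewrite inE/= in_itv/= => /andP[ax xb].
rewrite -[X in _ --> X](mulr1 1); apply: cvgM.
  under eq_fun do rewrite -mulrBr; apply: exp_germ1_scale_cvg.
  by rewrite subr_gt0.
under eq_fun do rewrite mulNr addrC -mulrBr.
by apply: exp_germ1_scale_cvg; rewrite subr_gt0.
Qed.

(** By Lebesgue differentiation, at almost every [x] the value [w x] is the limit of the means of
    [w] over the balls of radius 1/(n+1), all of which are 0. *)
Lemma itv_integrals_eq0 w : measurable_fun setT w ->
  (forall a b, L1 (fun x => w x * \1_`]a, b[ x)) ->
  (forall a b, \int[mu]_x (w x * \1_`]a, b[ x) = 0) ->
  {ae mu, forall x, w x = 0}.
Proof.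
move=> mw lw w0.
have lw' : locally_integrable setT w.
  split => // [|K _ cK]; first exact: openT.
  have [M [_ MK]] := compact_bounded cK.
  pose M' : R := `|M| + 1.
  have KM : K `<=` `]- (M' + 1), M' + 1[.
    move=> x Kx; rewrite /= in_itv/= -ltr_norml.
    rewrite (@le_lt_trans _ _ M')// ?ltrDl//.
    by apply: MK => //; rewrite /M' ltr_pwDr// ler_norm.
  have /integrableP[_] := lw (- (M' + 1)) (M' + 1).
  apply: le_lt_trans.
  rewrite integral_mkcond; apply: ge0_le_integral => //.
  - by move=> x _; rewrite /patch; case: ifP.
  - apply/(measurable_restrictT _ _).1; first exact: compact_measurable.
    apply/measurable_EFinP; apply: measurableT_comp => //.
    exact: measurable_funTS.
  - apply/measurable_EFinP; apply: measurableT_comp => //.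
    by apply: measurable_funM => //; exact: measurable_indic.
  - move=> x _; rewrite /patch; case: ifPn => [|_]; last by rewrite lee_fin.
    rewrite inE => /KM xM; rewrite lee_fin indicE mem_set//= mulr1 //.
pose E x (n : nat) : set R := ball x (n.+1%:R^-1 : R).
have nE x : nicely_shrinking x (E x).
  split=> [n|]; first exact: measurable_ball.
  exists (1, fun n => PosNum (divr_gt0 ltr01 (ltr0Sn R n))); split => //=.
  - by under eq_fun do rewrite div1r; exact: cvg_harmonic.
  - by move=> n; rewrite div1r.
  - by move=> n; rewrite div1r mul1e.
have := lebesgue_differentiation lw'; apply: ae_imply => x wx.
have := nice_lebesgue_differentiation nE lw' wx.
rewrite (_ : (fun n => _) = cst 0%E).
  move=> c0; suff : (w x)%:E = 0%E by case.
  exact: (cvg_unique _ c0 (cvg_cst _)).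
apply/funext => n /=; rewrite /E ball_itv/=.
have := w0 (x - n.+1%:R^-1) (x + n.+1%:R^-1).
set a := x - _; set b := x + _ => w0ab.
suff -> : (\int[mu]_(y in `]a, b[) (w y)%:E = 0)%E by rewrite mule0.
transitivity (\int[mu]_y (w y * \1_`]a, b[ y)%:E)%E.
  rewrite integral_mkcond; apply: eq_integral => y _; rewrite /patch indicE.
  by case: ifP => _; rewrite ?mulr1 ?mulr0.
rewrite -(fineK (integrable_fin_num measurableT (lw a b))).
by congr (_%:E); exact: w0ab.
Qed.

(** The bumps are test functions that converge to the indicator of an interval under domination by
    that indicator, so the integral of [w] over every bounded interval vanishes. Square
    integrability makes [w] integrable there. *)
Lemma fundamental_lemma w : measurable_fun setT w ->
  L1 (fun x => w x ^+ 2) ->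
  (forall phi, test_function phi -> \int[mu]_x (w x * phi x) = 0) ->
  {ae mu, forall x, w x = 0}.
Proof.
move=> mw lw2 w0.
have lind a b : L1 (\1_`]a, b[ : R -> R) by exact: integrable_indic_itv.
have mind a b : measurable_fun setT (\1_`]a, b[ : R -> R).
  exact: measurable_indic.
have lw a b : L1 (fun x => w x * \1_`]a, b[ x).
  apply: L1_Msquare => //; rewrite (_ : (fun x => _) = \1_`]a, b[)//.
  by apply/funext => x; rewrite indicE; case: (x \in _); rewrite ?expr1n ?expr0n.
apply: itv_integrals_eq0 => // a b.
have c : \int[mu]_x (w x * bump a b n x) @[n --> \oo] -->
         \int[mu]_x (w x * \1_`]a, b[ x).
  apply: (@Rintegral_cvg _ (measurableTypeR R) R mu
    (fun n x => w x * bump a b n x) (fun x => w x * \1_`]a, b[ x)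
    (fun x => `|w x * \1_`]a, b[ x|)).
  - move=> n; apply: measurable_funM => //.
    exact: (test_function_measurable (test_function_bump a b n)).
  - exact: measurable_funM.
  - by apply: aeW => x; exact: (cvgMl_tmp (a := w x) (@bump_cvg a b x)).
  - exact: L1_norm.
  - move=> n x /=; rewrite !(normrM (w x)) ler_wpM2l// indicE.
    rewrite (ger0_norm (bump_ge0 _ _ _ _)).
    case: (boolP (x \in _)) => xab; rewrite ?normr1 ?normr0.
      exact: bump_le1.
    by rewrite bump_out//; apply: contra xab => xab; rewrite inE.
apply: (cvg_unique _ c) => //.
rewrite (_ : (fun n => _) = cst 0); first exact: cvg_cst.
by apply/funext => n; rewrite w0//; exact: test_function_bump.
Qed.

End fundamental_lemma.

(** * Absolutely continuous functions *)

Section absolutely_continuous_lipschitz.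
Context {R : realType}.
Local Notation mu := (@lebesgue_measure R).
Implicit Types (f : R -> R) (a b x y z : R) (s : seq (R * R)) (U : set R).

(** The step is applied at the supremum of the points of [a, b] where [P] holds: it carries [P] from
    a point just below the supremum to one just above, unless [b] has been reached. *)
Lemma continuous_induction (P : R -> Prop) a b : a <= b -> P a ->
  (forall x, exists2 d : R, 0 < d & forall y z, x - d < y -> y <= x -> x <= z ->
     z < x + d -> P y -> P z) ->
  P b.
Proof.
move=> ab Pa step; pose S := [set x | a <= x <= b /\ P x].
have Sa : S a by split; rewrite ?lexx.
have ubS : ubound S b by move=> x [/andP[]].
have hS : has_sup S by split; [exists a|exists b].
have [d d0 dP] := step (sup S).
have [y Sy ySd] := sup_adherent d0 hS.
have yS : y <= sup S by exact: ub_le_sup hS.2 _ Sy.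
have aS : a <= sup S by exact: ub_le_sup hS.2 _ Sa.
have Sb : sup S <= b by exact: ge_sup hS.1 ubS.
(* As [z] belongs to [S], it cannot exceed [sup S]; the minimum must therefore be [b]. *)
pose z := Num.min b (sup S + d / 2).
have Sz : sup S <= z by rewrite le_min Sb lerDl divr_ge0// ltW.
have Pz : P z.
  apply: (dP y) => //; last by case: Sy.
  by rewrite gt_min ltrD2l gtr_pMr// invf_lt1// ltr1n orbT.
have : S z by split => //; rewrite (le_trans aS Sz)/= ge_min lexx.
move=> /(ub_le_sup hS.2); rewrite ge_min => /orP[bS|].
  have zb : z = b by apply/eqP; rewrite eq_le ge_min lexx/= (le_trans bS).
  by rewrite -zb.
by rewrite gerDl leNgt divr_gt0.
Qed.

(* The intervals of [s] are listed from right to left, starting below [x]. *)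
Fixpoint chain U x s : Prop :=
  if s is p :: s' then
    [/\ p.1 <= p.2, p.2 <= x, `]p.1, p.2[%classic `<=` U & chain U p.1 s']
  else True.

Lemma chain_le U x y s : x <= y -> chain U x s -> chain U y s.
Proof. by move=> xy; case: s => //= p s [? px ? ?]; split => //; exact: le_trans xy. Qed.

Lemma chain_nth U x s i : chain U x s -> (i < size s)%N ->
  [/\ (nth (0, 0) s i).1 <= (nth (0, 0) s i).2, (nth (0, 0) s i).2 <= x &
      `](nth (0, 0) s i).1, (nth (0, 0) s i).2[%classic `<=` U].
Proof.
elim: s x i => // p s IH x [|i] /= [p12 px pU cs]; first by split.
rewrite ltnS => /(IH _ _ cs)[le12 lep leU]; split => //.
exact: le_trans (le_trans lep p12) px.
Qed.

Lemma chain_nth_lt U x s i j : chain U x s -> (i < j < size s)%N ->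
  (nth (0, 0) s j).2 <= (nth (0, 0) s i).1.
Proof.
elim: s x i j => [|p s IH] x i [|j]; rewrite ?ltn0 ?andbF//.
case: i => [|i] /= [p12 px pU cs]; rewrite ?ltnS => h.
  by have [] := chain_nth cs h.
exact: IH cs h.
Qed.

(** Puts a chain in the form of the indexed disjoint families quantified over in
    [absolutely_continuous_on_R]. *)
Lemma chain_trivIset U x s : chain U x s ->
  trivIset setT (fun i : 'I_(size s) =>
    `](nth (0, 0) s i).1, (nth (0, 0) s i).2[%classic).
Proof.
move=> cs i j _ _ [z []] /=; rewrite !in_itv/= => /andP[iz zi] /andP[jz zj].
apply: val_inj => /=; have [ij|ji|//] := ltngtP i j.
- have /(chain_nth_lt cs) le_ji : (i < j < size s)%N by rewrite ij ltn_ord.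
  by have := lt_trans iz (lt_le_trans zj le_ji); rewrite ltxx.
- have /(chain_nth_lt cs) le_ij : (j < i < size s)%N by rewrite ji ltn_ord.
  by have := lt_trans jz (lt_le_trans zi le_ij); rewrite ltxx.
Qed.

(** Cutting [U] at [x] makes the induction additive: the head interval is disjoint from the part of
    [U] to its left, which contains the rest of the chain. *)
Lemma chain_length U x s : open U -> chain U x s ->
  ((\sum_(p <- s) (p.2 - p.1))%:E <= mu (U `&` `]-oo, x[))%E.
Proof.
move=> /open_measurable mU; elim: s x => [|p s IH] x /=.
  by rewrite big_nil measure_ge0.
move=> [p12 px pU cs]; rewrite big_cons EFinD.
have -> : (p.2 - p.1)%:E = mu `]p.1, p.2[.
  rewrite lebesgue_measure_itv/= lte_fin; case: ltP => // p21.
  by congr (_%:E); apply/eqP; rewrite subr_eq0 eq_le p12 p21.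
apply: (@le_trans _ _ (mu `]p.1, p.2[ + mu (U `&` `]-oo, p.1[))%E).
  by rewrite leeD2l// IH.
rewrite -measureU//; last 2 first.
- exact: measurableI.
- apply/seteqP; split => // z [/=]; rewrite !in_itv/= => /andP[pz _] [_ zp].
  by have := lt_trans pz zp; rewrite ltxx.
apply: le_measure; rewrite ?inE.
- by apply: measurableU => //; exact: measurableI.
- exact: measurableI.
- move=> z [zp|[Uz zp]]; split => //; first exact: pU.
    have : z \in `]p.1, p.2[%R by exact: zp.
    by rewrite /= !in_itv/= => /andP[_ /lt_le_trans]; exact.
  have : z \in `]-oo, p.1[%R by exact: zp.
  rewrite /= !in_itv/= => /lt_le_trans; apply; exact: le_trans px.
Qed.

Lemma derivable_growth f x M e : derivable f x 1 -> `|f^`() x| <= M -> 0 < e ->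
  exists2 d : R, 0 < d & forall y, `|y - x| < d ->
    `|f y - f x| <= (M + e) * `|y - x|.
Proof.
move=> dfx fM e0.
have /cvgrPdist_lt/(_ _ e0) : h^-1 *: ((f \o shift x) (h *: 1) - f x)
    @[h --> 0^'] --> f^`() x by rewrite derive1E; exact: dfx.
rewrite near_withinE => /nbhs_ballP[d /= d0 dP]; exists d => // y yx.
have [->|yx0] := eqVneq y x; first by rewrite !subrr normr0 mulr0.
have h0 : y - x != 0 by rewrite subr_eq0.
have := dP (y - x); rewrite /ball/= sub0r normrN => /(_ yx h0).
rewrite /GRing.scale/= mulr1 subrK => lte.
have : `|(y - x)^-1 * (f y - f x)| <= M + e.
  rewrite -[X in `|X|](subKr (f^`()%classic x)) (le_trans (ler_normB _ _))//.
  by rewrite lerD// ltW.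
by rewrite normrM normfV mulrC ler_pdivrMr ?normr_gt0.
Qed.

(* Enclose the exceptional null set in an open set [U] of small measure.  By
   continuous induction on [x], [f x - f a] is at most [(M + e) * (x - a)] plus
   the variation of [f] over a chain of intervals of [U], which absolute
   continuity makes small. *)
Lemma AC_ae_derive_bounded_lipschitz f M : 0 <= M -> absolutely_continuous_on_R f ->
  {ae mu, forall x, derivable f x 1 /\ `|f^`() x| <= M} ->
  forall a b, a <= b -> `|f b - f a| <= M * (b - a).
Proof.
move=> M0 ACf aef a b ab.
apply/ler_addgt0Pr => e0 e0_gt0.
(* Chosen so that the total error [e * (b - a) + e] equals [e0]. *)
pose e := e0 / (b - a + 1).
have ba1 : 0 < b - a + 1 by rewrite ltr_wpDl// subr_ge0.
have e_gt0 : 0 < e by rewrite divr_gt0.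
suff : `|f b - f a| <= (M + e) * (b - a) + e.
  move=> /le_trans; apply; rewrite mulrDl -addrA lerD2l.
  by rewrite -[X in _ + X]mulr1 -mulrDr divfK// gt_eqF.
have [d d0 dP] := ACf e e_gt0.
pose N := ~` [set x | derivable f x 1 /\ `|f^`() x| <= M].
have /negligible_outer_measure N0 : mu.-negligible N by exact: aef.
have [|U [oU NU Ud]] := @outer_measure_open_le R N (d / 2).
  by rewrite divr_gt0.
have Ultd : (mu U < d%:E)%E.
  apply: le_lt_trans Ud _; rewrite N0 add0e lte_fin.
  by rewrite ltr_pdivrMr// ltr_pMr// ltr1n.
pose P x := exists2 s, chain U x s &
  `|f x - f a| <= (M + e) * (x - a) + \sum_(p <- s) `|f p.2 - f p.1|.
have [s cs fab] : P b.
  apply: (continuous_induction ab).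
    by exists [::] => //; rewrite big_nil !subrr normr0 mulr0 addr0.
  move=> x; have [Nx|nNx] := pselect (N x).
    (* At an exceptional point nothing is known of the increment from [y] to [z]: it is charged to
       the chain, which is extended by the interval ]y, z[ of [U]. *)
    have := open_subball oU (NU _ Nx); rewrite near_withinE.
    move=> /nbhs_ballP[r /= r0 rU].
    exists (r / 2); first by rewrite divr_gt0.
    move=> y z xy yx xz zx [s cs fya]; exists ((y, z) :: s).
      split => //=; first exact: le_trans xz.
      move=> t /=; rewrite in_itv/= => /andP[yt tz].
      have r20 : 0 < r / 2 by rewrite divr_gt0.
      apply: (rU (r / 2)) => //=.
        by rewrite /ball/= sub0r normrN gtr0_norm// ltr_pdivrMr// ltr_pMr// ltr1n.
      by rewrite /ball/= ltr_distl; apply/andP; split; lra.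
    rewrite big_cons/= addrCA -(subrKA (f y)) (le_trans (ler_normD _ _))//.
    rewrite lerD2l (le_trans fya)// lerD2r ler_wpM2l ?addr_ge0// ?(ltW e_gt0)//.
    by rewrite lerB// (le_trans yx).
  (* At a regular point the chain is kept, and the increments on both sides of [x] are paid for by
     the slope [M + e]. *)
  have /contrapT[df fM] := nNx.
  have [r r0 rP] := derivable_growth df fM e_gt0.
  exists r => // y z xy yx xz zx [s cs fya]; exists s.
    by apply: chain_le cs; exact: le_trans xz.
  have := rP y; have := rP z.
  rewrite (ger0_norm (_ : 0 <= z - x)) ?subr_ge0// ltrBlDl => /(_ zx) fz.
  rewrite (ler0_norm (_ : y - x <= 0)) ?subr_le0// opprB.
  have xyr : x - y < r by rewrite ltrBlDr -ltrBlDl.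
  rewrite distrC => /(_ xyr) fy.
  have -> : f z - f a = (f z - f x) + ((f x - f y) + (f y - f a)) by ring.
  rewrite (le_trans (ler_normD _ _))// (le_trans (lerD fz (ler_normD _ _)))//.
  by rewrite (le_trans (lerD (lexx _) (lerD fy fya)))//; nra.
have Ub : (mu (U `&` `]-oo, b[) <= mu U)%E.
  apply: le_measure; rewrite ?inE; [|exact: open_measurable|by move=> t []].
  by apply: measurableI => //; exact: open_measurable.
have := le_lt_trans (le_trans (chain_length oU cs) Ub) Ultd; rewrite lte_fin.
rewrite (big_nth (0, 0)) big_mkord => len_s.
have := dP _ _ _ _ (chain_trivIset cs) len_s.
have le12 (i : 'I_(size s)) : (nth (0, 0) s i).1 <= (nth (0, 0) s i).2.
  by have [] := chain_nth cs (ltn_ord i).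
move=> /(_ le12) /ltW sum_le; apply: (le_trans fab).
by rewrite lerD2l (big_nth (0, 0)) big_mkord.
Qed.

End absolutely_continuous_lipschitz.

(** * Translations and reflections of the Lebesgue integral *)

Section lebesgue_reflection.
Context {R : realType}.
Local Notation mu := (@lebesgue_measure R).
Local Notation L1 f := (mu.-integrable setT (EFin \o f)).
Implicit Types (f : R -> R) (d : R).

(** Reflections serve twice: translations are composites of two of them, and the map y |-> x - y of
    a convolution is one. *)
Definition reflect_at d : measurableTypeR R -> measurableTypeR R :=
  fun x => d - x.

Lemma measurable_reflect d : measurable_fun setT (reflect_at d).
Proof. by apply: measurable_funB => //; exact: measurable_cst. Qed.

(** By uniqueness of the Lebesgue measure it suffices to test half-open intervals; reflection
    exchanges the closed end and the open one but preserves the length. *)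
Lemma lebesgue_measure_reflect d (A : set R) : measurable A ->
  pushforward mu (reflect_at d) A = mu A.
Proof.
move=> mA; apply/esym; move: A mA.
apply: lebesgue_measure_unique; first exact: measurable_reflect.
move=> mphi _ [[a b]] _ <-; rewrite /= /pushforward.
rewrite (_ : _ @^-1` _ = `[d - b, d - a[); last first.
  by apply/seteqP; split => x; rewrite /= !in_itv/= /reflect_at => /andP[? ?];
    apply/andP; split; lra.
rewrite !lebesgue_measure_itv/= !lte_fin ltrD2l ltrN2.
by case: ifP => // _; congr (_%:E); ring.
Qed.

Lemma ge0_integral_reflect d (f : R -> \bar R) : measurable_fun setT f ->
  (forall x, 0 <= f x)%E -> (\int[mu]_x f (d - x)%R = \int[mu]_x f x)%E.
Proof.
move=> mf f0.
transitivity (\int[pushforward mu (reflect_at d)]_x f x)%E.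
  by rewrite ge0_integral_pushforward//; exact: measurable_reflect.
apply: eq_measure_integral; first exact: measurable_reflect.
by move=> mphi A mA _; exact: lebesgue_measure_reflect.
Qed.

Lemma L1_reflect d f : L1 f -> L1 (fun x => f (d - x)).
Proof.
move=> /integrableP[/measurable_EFinP mf foo]; apply/integrableP; split.
  apply/measurable_EFinP; exact: (measurableT_comp mf (measurable_reflect d)).
rewrite (@ge0_integral_reflect d (fun x => `|(f x)%:E|%E))//.
by apply/measurable_EFinP; exact: measurableT_comp.
Qed.

Lemma Rintegral_reflect d f : L1 f -> \int[mu]_x f (d - x) = \int[mu]_x f x.
Proof.
move=> lf; rewrite /Rintegral; congr fine.
transitivity (\int[pushforward mu (reflect_at d)]_x (f x)%:E)%E.
  have mEf : measurable_fun setT (EFin \o f) by exact: measurable_int lf.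
  have lfd := L1_reflect d lf.
  have := integral_pushforward (measurable_reflect d) mEf lfd measurableT.
  by rewrite preimage_setT.
apply: eq_measure_integral; first exact: measurable_reflect.
by move=> mphi A mA _; exact: lebesgue_measure_reflect.
Qed.

Lemma L1_translate d f : L1 f -> L1 (fun x => f (x + d)).
Proof.
move=> lf; have := L1_reflect 0 (L1_reflect d lf).
by apply: eq_integrable => // x _ /=; rewrite sub0r opprK addrC.
Qed.

Lemma Rintegral_translate d f : L1 f -> \int[mu]_x f (x + d) = \int[mu]_x f x.
Proof.
move=> lf; rewrite -(Rintegral_reflect d lf).
rewrite -(Rintegral_reflect 0 (L1_reflect d lf)).
by apply: eq_Rintegral => x _; rewrite sub0r opprK addrC.
Qed.

End lebesgue_reflection.

(** * Lipschitz integrable functions *)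

Section lipschitz_integrable.
Context {R : realType}.
Local Notation mu := (@lebesgue_measure R).
Local Notation L1 f := (mu.-integrable setT (EFin \o f)).
Implicit Types (f F phi : R -> R) (d x y L : R) (h : nat -> R).

Definition lipschitz_with L f := forall x y, `|f x - f y| <= L * `|x - y|.

Lemma lipschitz_with_ge0 L f : lipschitz_with L f -> 0 <= L.
Proof.
by move=> /(_ 1 0); rewrite subr0 normr1 mulr1; exact: le_trans.
Qed.

Lemma lipschitz_with_continuous L f : lipschitz_with L f -> continuous f.
Proof.
move=> fL x; have L0 := lipschitz_with_ge0 fL.
apply/cvgrPdist_lt => e e0.
have r0 : 0 < e / (L + 1) by rewrite divr_gt0// ltr_wpDl.
near=> y.
apply: le_lt_trans (fL _ _) _; apply: (@le_lt_trans _ _ ((L + 1) * `|x - y|)).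
  by rewrite ler_wpM2r// lerDl.
by rewrite mulrC -ltr_pdivlMr ?ltr_wpDl//; near: y; exact: (nbhsx_ballx x _ r0).
Unshelve. all: by end_near. Qed.

Lemma L1_on (A : set R) f : measurable A -> L1 f -> mu.-integrable A (EFin \o f).
Proof. by move=> mA; apply: integrableS. Qed.

(** On [x, x + d] one has |f x| <= |f z| + L d; integrating in z turns integral information into
    pointwise bounds. *)
Lemma lipschitz_local_mean L f d x : lipschitz_with L f -> L1 f -> 0 < d ->
  d * `|f x| <= \int[mu]_(z in `[x, x + d]) `|f z| + L * d ^+ 2.
Proof.
move=> fL lf d0; have L0 := lipschitz_with_ge0 fL.
have mD : fine (mu [set` `[x, x + d]%R]) = d.
  by rewrite lebesgue_measure_itv/= lte_fin ltrDl d0/= addrC addKr.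
have cst_int c : mu.-integrable `[x, x + d] (EFin \o cst c).
  apply: measurable_bounded_integrable => //=.
    by rewrite lebesgue_measure_itv/=; case: ifP => // _; rewrite -EFinB ltry.
  exact: bounded_cst.
have lfD : mu.-integrable `[x, x + d] (EFin \o (fun z => `|f z|)).
  by apply: L1_on => //; exact: L1_norm.
have lfL : mu.-integrable `[x, x + d] (EFin \o (fun z => `|f z| + L * d)).
  exact: (integrableD _ lfD (cst_int (L * d))).
have := @le_Rintegral _ _ _ mu `[x, x + d] (fun=> `|f x|)
  (fun z => `|f z| + L * d) (measurable_itv _) (cst_int _) lfL.
rewrite Rintegral_cst// [fine _]mD.
rewrite (@RintegralD _ _ _ mu _ _ (fun=> L * d) (measurable_itv _) lfD (cst_int _)).
rewrite Rintegral_cst// [fine _]mD => mean.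
rewrite expr2 mulrA mulrC; apply: mean => z.
rewrite /= in_itv/= => /andP[xz zx].
rewrite -lerBlDl (le_trans (lerB_dist _ _))// (le_trans (fL _ _))//.
by rewrite ler_wpM2l// ler0_norm ?subr_le0// opprB lerBlDl.
Qed.

Lemma le_Rintegral_subset (A : set R) f : measurable A -> L1 f ->
  (forall x, 0 <= f x) -> \int[mu]_(x in A) f x <= \int[mu]_x f x.
Proof.
move=> mA lf f0; rewrite fine_le//.
- by apply: integrable_fin_num => //; exact: L1_on.
- exact: integrable_fin_num.
- apply: ge0_subset_integral => //; first exact: measurable_int lf.
  by move=> x _; rewrite lee_fin.
Qed.

Lemma lipschitz_L1_bounded L f : lipschitz_with L f -> L1 f ->
  forall x, `|f x| <= \int[mu]_x `|f x| + L.
Proof.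
move=> fL lf x; have := lipschitz_local_mean x fL lf ltr01.
rewrite mul1r expr1n mulr1 => /le_trans; apply; rewrite lerD2r.
by apply: le_Rintegral_subset => //; exact: L1_norm.
Qed.

(** Dominated convergence for |f| restricted to |x| >= k, followed by monotonicity in [A]. *)
Lemma L1_tail f e : L1 f -> 0 < e -> exists k : nat, forall A : set R,
  measurable A -> (forall x, A x -> k%:R <= `|x|) ->
  \int[mu]_(x in A) `|f x| < e.
Proof.
move=> lf e0; have mf := L1_measurable lf.
pose T_ (k : nat) : set R := [set x | k%:R <= `|x|].
have mT k : measurable (T_ k).
  rewrite (_ : T_ k = (fun x : R => `|x|) @^-1` `[k%:R, +oo[); last first.
    by apply/seteqP; split => x; rewrite /= in_itv/= andbT.
  by rewrite -[X in measurable X]setTI; exact: normr_measurable.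
pose g k x := `|f x| * \1_(T_ k) x.
have mg k : measurable_fun setT (g k).
  by apply: measurable_funM; [exact: measurableT_comp|exact: measurable_indic].
have g0 : \int[mu]_x g k x @[k --> \oo] --> (0 : R).
  rewrite -(_ : \int[mu]_x (cst 0 x) = 0); last first.
    by rewrite Rintegral_cst// mul0r.
  apply: (@Rintegral_cvg _ (measurableTypeR R) R mu g (cst 0)
    (fun x => `|f x|)) => //.
  - apply: aeW => x; apply: cvg_near_cst; near=> k.
    rewrite /g indicE memNset ?mulr0// /T_/= => xk.
    have : k%:R <= `|x| by [].
    apply/negP; rewrite -ltNge; near: k.
    exact: nbhs_infty_gtr.
  - exact: L1_norm.
  - move=> k x; rewrite /g normrM normr_id ler_piMr// indicE.
    by case: (_ \in _); rewrite ?normr1 ?normr0.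
move/cvgrPdist_lt : g0 => /(_ _ e0)[k _ /(_ k (leqnn k))]/=.
rewrite sub0r normrN => ge; exists k => A mA AT.
apply: le_lt_trans (le_lt_trans (ler_norm _) ge).
have lg : L1 (g k).
  apply: (@L1_le _ (measurableTypeR R) R mu _ _ (mg k) _ (L1_norm lf)) => x.
  rewrite /g normrM normr_id ler_piMr//.
  by rewrite indicE; case: (_ \in _); rewrite ?normr1 ?normr0.
apply: (@le_trans _ _ (\int[mu]_(x in A) g k x)).
  apply: le_Rintegral => //.
  - exact: L1_on (L1_norm lf).
  - exact: L1_on lg.
  - by move=> x Ax; rewrite /g indicE mem_set ?mulr1// /T_/=; exact: AT.
apply: le_Rintegral_subset => // x; rewrite /g mulr_ge0//.
Unshelve. all: by end_near. Qed.

Lemma lipschitz_L1_vanish L f e : lipschitz_with L f -> L1 f -> 0 < e ->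
  exists M : R, forall x, M <= `|x| -> `|f x| < e.
Proof.
move=> fL lf e0; have L0 := lipschitz_with_ge0 fL.
(* With this width the error [L * d ^+ 2] is at most [d * (e / 2)], which leaves the other half for
   the tail. *)
pose d := e / (2 * (L + 1)).
have d0 : 0 < d by rewrite divr_gt0// mulr_gt0// ltr_wpDl.
have [|k kP] := @L1_tail f (d * (e / 2)) lf; first by rewrite mulr_gt0// divr_gt0.
(* The margin [d] keeps all of [x, x + d] in the region |y| >= k, also for negative [x]. *)
exists (k%:R + d) => x kx; rewrite -(ltr_pM2l d0).
apply: le_lt_trans (lipschitz_local_mean x fL lf d0) _.
have -> : d * e = d * (e / 2) + d * (e / 2) by rewrite -mulrDr -splitr.
apply: ltr_leD.
  apply: kP => // y; rewrite /= in_itv/= => /andP[xy yx].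
  have : `|x| <= `|y| + `|x - y|.
    by have := ler_normD y (x - y); rewrite (addrC y (x - y)) subrK.
  rewrite (ler0_norm (_ : x - y <= 0)) ?subr_le0// opprB => h.
  move: kx; lra.
have L1_gt0 : 0 < L + 1 by rewrite ltr_wpDl.
have ed : e = d * (2 * (L + 1)) by rewrite /d divfK// gt_eqF// mulr_gt0.
rewrite [in leRHS]ed.
by nra.
Unshelve. all: by end_near. Qed.

Lemma lipschitz_L1_C0 L f : lipschitz_with L f -> L1 f -> C0 f.
Proof.
move=> fL lf; split; first exact: lipschitz_with_continuous fL.
- apply/cvgr0Pnorm_lt => e e0; have [M MP] := lipschitz_L1_vanish fL lf e0.
  exists M; split => [|x Mx]; first exact: num_real.
  by apply: MP; exact: le_trans (ltW Mx) (ler_norm x).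
- apply/cvgr0Pnorm_lt => e e0; have [M MP] := lipschitz_L1_vanish fL lf e0.
  exists (- M); split => [|x Mx]; first exact: num_real.
  apply: MP; rewrite -normrN; apply: le_trans (ler_norm (- x)).
  by rewrite lerNr ltW.
Qed.

End lipschitz_integrable.

(** * Integration by parts for Lipschitz functions *)

Section lipschitz_weak_derivative.
Context {R : realType}.
Local Notation mu := (@lebesgue_measure R).
Local Notation L1 f := (mu.-integrable setT (EFin \o f)).
Implicit Types (f F phi : R -> R) (x y L C : R) (h : nat -> R).

Lemma difference_quotient_cvg f x h : derivable f x 1 ->
  h @ \oo --> (0 : R) -> (forall n, h n != 0) ->
  (h n)^-1 * (f (x + h n) - f x) @[n --> \oo] --> f^`() x.
Proof.
move=> dfx h0 hn0.
have : t^-1 *: ((f \o shift x) (t *: 1) - f x) @[t --> 0^'] --> f^`() x.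
  by rewrite derive1E; exact: dfx.
move=> /cvgrPdist_lt dfP; apply/cvgrPdist_lt => e e0.
have := dfP _ e0; rewrite near_withinE => /nbhs_ballP[d /= d0 dP].
move/cvgrPdist_lt : h0 => /(_ _ d0) [N _ hN].
exists N => // n /= Nn.
have := dP (h n) (hN n Nn) (hn0 n).
by rewrite /GRing.scale/= mulr1 (addrC x).
Qed.

Lemma derivable_lipschitz f C : (forall x, derivable f x 1) ->
  (forall x, `|f^`() x| <= C) -> lipschitz_with C f.
Proof.
move=> df fC.
have cf : continuous f.
  by move=> x; apply: differentiable_continuous; apply/derivable1_diffP.
suff le x y : x <= y -> `|f x - f y| <= C * `|x - y|.
  move=> x y; have [xy|/ltW yx] := leP x y; first exact: le.
  by rewrite distrC (distrC x); exact: le.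
move=> xy; rewrite distrC (distrC x).
have [||z _ ->] := @MVT_segment R f f^`() x y xy; last first.
- by rewrite normrM ler_wpM2r.
- exact: continuous_subspaceT.
- by move=> z _; apply: DeriveDef; [exact: df|rewrite derive1E].
Qed.

Lemma test_function_lipschitz phi : test_function phi ->
  exists C : R, lipschitz_with C phi.
Proof.
move=> tphi; have [C phiC] := test_function_bounded (test_function_derive1 tphi).
exists C; apply: derivable_lipschitz phiC => x.
by have sphi := test_function_smooth tphi; exact: (sphi 0%N x).
Qed.

(* Both sides are limits of the same difference quotients, the increment being
   moved from the test function to [f] by translation invariance. *)
Lemma lipschitz_integration_by_parts L f F phi : lipschitz_with L f -> L1 f ->
  measurable_fun setT F -> {ae mu, forall x, derivable f x 1 /\ f^`() x = F x} ->
  test_function phi ->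
  \int[mu]_x (f x * phi^`()%classic x) = - \int[mu]_x (F x * phi x).
Proof.
move=> fL lf mF fF tphi.
have [C phiC] := test_function_lipschitz tphi.
have mf := L1_measurable lf; have mphi := test_function_measurable tphi.
have lphi := test_function_L1 tphi.
have [B phiB] := test_function_bounded tphi.
pose h n : R := n.+1%:R^-1.
have h_gt0 n : 0 < h n by rewrite invr_gt0.
have h0 : h @ \oo --> (0 : R) by exact: cvg_harmonic.
have L0 := lipschitz_with_ge0 fL; have C0 := lipschitz_with_ge0 phiC.
pose A n x := f x * ((h n)^-1 * (phi (x + h n) - phi x)).
(* The increment is [- h n] because the translation that takes [phi (x + h n)] to [phi x] takes
   [f x] to [f (x - h n)]; this is also the source of the minus sign. *)
pose D n x := ((- h n)^-1 * (f (x - h n) - f x)) * phi x.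
have mtr (g : R -> R) (c : R) : measurable_fun setT g ->
    measurable_fun setT (fun x : R => g (x + c)).
  by move=> mg; apply: measurableT_comp => //; exact: measurable_funD.
have cA : \int[mu]_x A n x @[n --> \oo] --> \int[mu]_x (f x * phi^`()%classic x).
  apply: (@Rintegral_cvg _ (measurableTypeR R) R mu A _ (fun x => C * `|f x|)).
  - move=> n; apply: measurable_funM => //; apply: measurable_funM => //.
    by apply: measurable_funB => //; exact: mtr.
  - apply: measurable_funM => //.
    exact: test_function_measurable (test_function_derive1 tphi).
  - apply: aeW => x.
    apply: (cvgMl_tmp (a := f x)); apply: difference_quotient_cvg => //.
      by have sphi := test_function_smooth tphi; exact: (sphi 0%N x).
    by move=> n; rewrite gt_eqF.
  - exact/L1Zl/L1_norm.
  - move=> n x; rewrite /A normrM mulrC ler_wpM2r// normrM normfV.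
    rewrite mulrC ler_pdivrMr ?normr_gt0 ?gt_eqF// (le_trans (phiC _ _))//.
    by rewrite addrAC subrr add0r.
have cD : \int[mu]_x D n x @[n --> \oo] --> \int[mu]_x (F x * phi x).
  apply: (@Rintegral_cvg _ (measurableTypeR R) R mu D _ (fun x => L * `|phi x|)).
  - move=> n; apply: measurable_funM => //; apply: measurable_funM => //.
    by apply: measurable_funB => //; exact: mtr.
  - exact: measurable_funM.
  - apply: ae_imply fF => x [dfx <-].
    apply: (cvgMr_tmp (b := phi x)).
    apply: (@difference_quotient_cvg f x (fun n => - h n)) => //.
      by rewrite -oppr0; exact: cvgN.
    by move=> n; rewrite oppr_eq0 gt_eqF.
  - exact/L1Zl/L1_norm.
  - move=> n x; rewrite /D normrM ler_wpM2r// normrM normfV normrN.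
    rewrite mulrC ler_pdivrMr ?normr_gt0 ?gt_eqF// (le_trans (fL _ _))//.
    by rewrite addrAC subrr add0r normrN.
have lfphi : L1 (fun x => f x * phi x).
  have : L1 (fun x => phi x * f x) 
    by exact: (@L1_Mbounded _ (measurableTypeR R) R mu _ _ _ mphi phiB lf).
  by apply: eq_integrable => // x _ /=; rewrite mulrC.
have lfphi1 n : L1 (fun x => f x * phi (x + h n)).
  have : L1 (fun x => phi (x + h n) * f x).
    by apply: (@L1_Mbounded _ (measurableTypeR R) R mu _ _ B) => //; exact: mtr.
  by apply: eq_integrable => // x _ /=; rewrite mulrC.
have lfphi2 n : L1 (fun x => f (x - h n) * phi x).
  have := L1_translate (- h n) (lfphi1 n).
  by apply: eq_integrable => // x _ /=; rewrite subrK.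
have AD n : \int[mu]_x A n x = - \int[mu]_x D n x.
  transitivity ((h n)^-1 * (\int[mu]_x (f x * phi (x + h n)) -
      \int[mu]_x (f x * phi x))).
    rewrite -RintegralB// -RintegralZl//; last exact: L1B.
    by apply: eq_Rintegral => x _; rewrite /A mulrCA mulrBr.
  rewrite -(Rintegral_translate (- h n) (lfphi1 n)).
  under eq_Rintegral do rewrite subrK.
  rewrite -RintegralB// -RintegralZl//; last exact: L1B.
  rewrite -[RHS]mulN1r -RintegralZl//.
    apply: eq_Rintegral => x _; rewrite /D mulN1r invrN !mulNr opprK.
    by rewrite -mulrA mulrBl.
  have : L1 (fun x => (- h n)^-1 * (f (x - h n) * phi x - f x * phi x)).
    exact/L1Zl/L1B.
  by apply: eq_integrable => // x _ /=; rewrite /D -mulrA mulrBl.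
apply: (cvg_unique _ cA) => //.
have -> : (fun n => \int[mu]_x A n x) = (fun n => - \int[mu]_x D n x).
  exact/funext.
exact: cvgN.
Qed.

End lipschitz_weak_derivative.

(** * The bounded Lipschitz distance *)

Section bounded_lipschitz_duality.
Context {R : realType}.
Local Notation T := (measurableTypeR R).
Implicit Types (f g : R -> R) (C K L : R).

Lemma finite_bounded_L1 d (X : measurableType d) (m : {finite_measure set X -> \bar R})
    (f : X -> R) C : measurable_fun setT f -> (forall x, `|f x| <= C) ->
  m.-integrable setT (EFin \o f).
Proof.
move=> mf fC; apply: (@L1_le _ _ _ m _ (cst C)) => //.
exact: finite_measure_integrable_cst.
Qed.

Lemma fin_num_subC_add (a b c e : \bar R) : a \is a fin_num -> b \is a fin_num ->
  c \is a fin_num -> e \is a fin_num -> (c - e = a - b -> a + e = b + c)%E.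
Proof.
move: a b c e => [a| |] [b| |] [c| |] [e| |] // _ _ _ _.
by rewrite -!EFinB -!EFinD => -[h]; congr (_%:E); lra.
Qed.

Lemma fine_addC_sub (a b c e : \bar R) : a \is a fin_num -> b \is a fin_num ->
  c \is a fin_num -> e \is a fin_num -> (a + e = b + c)%E ->
  fine a - fine b = fine c - fine e.
Proof.
move: a b c e => [a| |] [b| |] [c| |] [e| |] // _ _ _ _.
by rewrite -!EFinD => -[h] /=; lra.
Qed.

(** The Jordan parts [p] and [q] of m1 - m2 are in general not m1 and m2. However p + m2 = q + m1 as
    measures, and the integrals of a bounded function against these finite sums can be
    rearranged. *)
Lemma charge_integral_sub (m1 m2 : subprobability T R) f C :
  measurable_fun setT f -> (forall x, `|f x| <= C) ->
  charge_integral (cadd (charge_of_finite_measure m1)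
                        (copp (charge_of_finite_measure m2))) f =
  \int[m1]_x f x - \int[m2]_x f x.
Proof.
move=> mf fC; rewrite /charge_integral.
set nu := cadd _ _; set PN := projT2 _.
pose p : {finite_measure set T -> \bar R} := jordan_pos PN.
pose q : {finite_measure set T -> \bar R} := jordan_neg PN.
have Ifin (m : {finite_measure set T -> \bar R}) : m.-integrable setT (EFin \o f).
  exact: (@finite_bounded_L1 _ T m f C mf fC).
have pq A : measurable A -> measure_add p m2 A = measure_add q m1 A.
  move=> mA; rewrite !measure_addE.
  have dec : (m1 A - m2 A = p A - q A)%E.
    by have := jordan_decomp PN mA; rewrite /cadd /= cscaleN1.
  by apply: fin_num_subC_add dec; exact: fin_num_measure.
have : (\int[measure_add p m2]_x (f x)%:E = \int[measure_add q m1]_x (f x)%:E)%E.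
  by apply: eq_measure_integral => A mA _; exact: pq.
rewrite !integral_measure_add//; try exact: Ifin; try exact/measurable_EFinP.
by apply: fine_addC_sub; apply: integrable_fin_num => //; exact: Ifin.
Qed.

(** Dividing [g] by [K] makes it admissible in the supremum. Taking [K] to be any positive bound of
    [C + L] covers the case where both constants vanish. *)
Lemma BL_dist_test (m1 m2 : subprobability T R) g C L K : C0 g ->
  (forall x, `|g x| <= C) -> lipschitz_with L g -> 0 < K -> C + L <= K ->
  ((\int[m1]_x g x - \int[m2]_x g x)%:E <= K%:E * BL_dist m1 m2)%E.
Proof.
move=> [cg gy gNy] gC gL K0 CLK; pose f x := K^-1 * g x.
have K1 : K^-1 = `|K^-1| by rewrite gtr0_norm ?invr_gt0.
have mg : measurable_fun setT g by exact: continuous_measurable_fun.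
have lg (m : subprobability T R) : m.-integrable setT (EFin \o g).
  exact: (@finite_bounded_L1 _ T m g C mg gC).
have fC0 : C0 f.
  split.
  - by move=> x; apply: (cvgMl_tmp (a := K^-1)); exact: cg.
  - by rewrite -(mulr0 K^-1); exact: (cvgMl_tmp (a := K^-1)).
  - by rewrite -(mulr0 K^-1); exact: (cvgMl_tmp (a := K^-1)).
have fK : (sup_norm f + Lip f <= 1)%E.
  apply: (@le_trans _ _ ((K^-1 * C)%:E + (K^-1 * L)%:E)%E); last first.
    rewrite -EFinD lee_fin -mulrDr -(mulVf (negbT (gt_eqF K0))) ler_pM2l ?invr_gt0//.
  apply: leeD; apply: ge_ereal_sup => /= _ [x xP <-]; rewrite lee_fin.
    by rewrite normrM -K1 ler_pM2l ?invr_gt0//.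
  rewrite ler_pdivrMr ?normr_gt0 ?subr_eq0//.
  by rewrite /f -mulrBr normrM -K1 -mulrA ler_pM2l ?invr_gt0//.
have : ((K^-1 * (\int[m1]_x g x - \int[m2]_x g x))%:E <= BL_dist m1 m2)%E.
  apply: ereal_sup_ubound; exists f => //.
  rewrite (@charge_integral_sub _ _ _ (K^-1 * C)).
  - by rewrite (RintegralZl _ measurableT (lg m1))
      (RintegralZl _ measurableT (lg m2)) -mulrBr.
  - exact: measurable_funM.
  - by move=> x; rewrite normrM -K1 ler_pM2l ?invr_gt0//.
by rewrite EFinM lee_pdivrMl.
Qed.

End bounded_lipschitz_duality.

(** * Convolution with a measure *)

Section real_fubini.
Context d1 d2 (X : measurableType d1) (Y : measurableType d2) (R : realType).
Variables (m1 : {sigma_finite_measure set X -> \bar R}).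
Variables (m2 : {sigma_finite_measure set Y -> \bar R}).
Variable f : X -> Y -> R.
Hypothesis lf : (m1 \x m2)%E.-integrable setT (EFin \o (fun z => f z.1 z.2)).
(** Sections are required to be integrable at every point, so that the inner real integrals agree
    everywhere with the extended ones and no exceptional set arises. *)
Hypothesis lf2 : forall x, m2.-integrable setT (EFin \o f x).
Hypothesis lf1 : forall y, m1.-integrable setT (EFin \o f^~ y).

Let EFin_int2 x : (\int[m2]_y (f x y)%:E)%E = (\int[m2]_y f x y)%:E.
Proof. by rewrite fineK//; exact: (integrable_fin_num measurableT (lf2 x)). Qed.

Let EFin_int1 y : (\int[m1]_x (f x y)%:E)%E = (\int[m1]_x f x y)%:E.
Proof. by rewrite fineK//; exact: (integrable_fin_num measurableT (lf1 y)). Qed.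

Lemma L1_fubini1 : m1.-integrable setT (EFin \o (fun x => \int[m2]_y f x y)).
Proof.
have := integrable_fubini_F lf; apply: eq_integrable => // x _ /=.
exact: EFin_int2.
Qed.

Lemma L1_fubini2 : m2.-integrable setT (EFin \o (fun y => \int[m1]_x f x y)).
Proof.
have mf := measurable_int _ lf.
have G_int : m2.-integrable setT (fun y => \int[m1]_x (f x y)%:E)%E.
  apply/integrableP; split; first exact: measurable_fubini_G lf.
  apply: le_lt_trans ((integrable21ltyP _ _ mf).1 lf).
  apply: ge0_le_integral => //.
  - by apply: measurableT_comp => //; exact: measurable_fubini_G lf.
  - apply: (measurable_fun_fubini_tonelli_G
      (fun z => `|(f z.1 z.2)%:E|%E)) => //.
    exact: measurableT_comp mf.
  - move=> y _; apply: le_abse_integral => //; exact: measurable_int (lf1 y).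
apply: eq_integrable G_int => // y _ /=; exact: EFin_int1.
Qed.

Lemma Rintegral_fubini :
  \int[m1]_x (\int[m2]_y f x y) = \int[m2]_y (\int[m1]_x f x y).
Proof.
rewrite [LHS]/Rintegral [RHS]/Rintegral; congr fine.
under eq_integral do rewrite -EFin_int2.
under [RHS]eq_integral do rewrite -EFin_int1.
exact: (Fubini lf).
Qed.

End real_fubini.

Section convolution.
Context {R : realType}.
Local Notation mu := (@lebesgue_measure R).
Local Notation T := (measurableTypeR R).
Local Notation L1 f := (mu.-integrable setT (EFin \o f)).
Variables (F : R -> R) (B : R).
Hypothesis mF : measurable_fun setT F.
Hypothesis FB : forall x, `|F x| <= B.
Hypothesis lF : L1 F.
Local Notation normF := (\int[mu]_x `|F x|).

Let B0 : 0 <= B. Proof. exact: le_trans (FB 0). Qed.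

Lemma L1_kernel y : L1 (fun x => F (x - y)).
Proof. exact: L1_translate. Qed.

Lemma Rintegral_kernel_norm y : \int[mu]_x `|F (x - y)| = normF.
Proof. by rewrite (@Rintegral_translate _ (- y) (fun x => `|F x|))//; exact: L1_norm. Qed.

Lemma measurable_conv_kernel :
  measurable_fun setT (fun z : T * T => F (z.1 - z.2)).
Proof.
apply: (measurableT_comp mF).
by apply: measurable_funB; [exact: measurable_fst|exact: measurable_snd].
Qed.

Lemma measurable_kernel_snd x : measurable_fun setT (fun y : T => F (x - y)).
Proof. exact: (measurableT_comp mF (measurable_reflect x)). Qed.

Lemma measurable_kernel_mul (psi : R -> R) : measurable_fun setT psi ->
  measurable_fun setT (fun z : T * T => F (z.1 - z.2) * psi z.1).
Proof.
move=> mpsi; apply: measurable_funM; first exact: measurable_conv_kernel.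
by apply: (measurableT_comp mpsi); exact: measurable_fst.
Qed.

Lemma L1_kernel_mul (psi : R -> R) C y : measurable_fun setT psi ->
  (forall x, `|psi x| <= C) -> L1 (fun x => F (x - y) * psi x).
Proof.
move=> mpsi psiC.
have := @L1_Mbounded _ T R mu _ _ _ mpsi psiC (L1_kernel y).
by apply: eq_integrable => // x _ /=; rewrite mulrC.
Qed.

Lemma Rintegral_kernel_mul_le (psi : R -> R) C y : measurable_fun setT psi ->
  (forall x, `|psi x| <= C) ->
  \int[mu]_x `|F (x - y) * psi x| <= C * normF.
Proof.
move=> mpsi psiC; rewrite -(Rintegral_kernel_norm y) -RintegralZl//; last first.
  exact: L1_norm (L1_kernel y).
apply: le_Rintegral => //.
- exact: L1_norm (L1_kernel_mul y mpsi psiC).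
- exact/L1Zl/L1_norm/L1_kernel.
- by move=> x _; rewrite normrM mulrC ler_wpM2r.
Qed.

Section finite_measure.
Variable m : subprobability T R.

Lemma subprobability_mass : fine (m setT) <= 1.
Proof.
have := @sprobability_setT _ _ _ m.
by have := fin_num_measure m setT measurableT; case: (m setT) => //=.
Qed.

Lemma Rintegral_subprobability_le (f : R -> R) C : 0 <= C ->
  m.-integrable setT (EFin \o f) -> (forall x, f x <= C) -> \int[m]_x f x <= C.
Proof.
move=> C0 lf fC; apply: (@le_trans _ _ (\int[m]_x (cst C x))).
  by apply: le_Rintegral => //; exact: finite_measure_integrable_cst.
by rewrite Rintegral_cst// ler_piMr// subprobability_mass.
Qed.

Lemma L1_kernel_snd x : m.-integrable setT (EFin \o (fun y => F (x - y))).
Proof.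
exact: (@finite_bounded_L1 _ _ T m _ B (measurable_kernel_snd x)).
Qed.

Lemma conv_measure_bounded x : `|conv_measure F m x| <= B.
Proof.
apply: le_trans (le_normr_Rintegral measurableT (L1_kernel_snd x)) _.
by apply: Rintegral_subprobability_le => //; exact/L1_norm/L1_kernel_snd.
Qed.

(** Tonelli with the Lebesgue integral inside: it is at most [C * normF] for every [y], and [m] is
    finite. *)
Lemma kernel_mul_product_L1 (psi : R -> R) C : measurable_fun setT psi ->
  (forall x, `|psi x| <= C) ->
  (mu \x m)%E.-integrable setT (EFin \o (fun z => F (z.1 - z.2) * psi z.1)).
Proof.
move=> mpsi psiC; apply/integrable21ltyP.
  by apply/measurable_EFinP; exact: measurable_kernel_mul.
have C0 : 0 <= C by exact: le_trans (psiC 0).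
apply: (@le_lt_trans _ _ (\int[m]_y (C * normF)%:E)%E); last first.
  by rewrite integral_cst//= -ge0_fin_numE ?fin_numM ?fin_num_measure//
    mule_ge0// lee_fin mulr_ge0// Rintegral_ge0.
apply: ge0_le_integral => //.
- by move=> y _; exact: integral_ge0.
- apply: (measurable_fun_fubini_tonelli_G
    (fun z : T * T => `|(F (z.1 - z.2) * psi z.1)%:E|%E)) => //.
  apply/measurable_EFinP; apply: measurableT_comp => //.
  exact: measurable_kernel_mul.
- move=> y _; have lpsi := L1_norm (L1_kernel_mul y mpsi psiC).
  have /= <- : ((\int[mu]_x `|F (x - y) * psi x|)%:E =
      \int[mu]_x `|(F (x - y) * psi x)%:E|)%E.
    by rewrite /Rintegral fineK//; exact: (integrable_fin_num measurableT lpsi).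
  by rewrite lee_fin Rintegral_kernel_mul_le.
Qed.

Lemma L1_kernel_snd_mul x c : m.-integrable setT (EFin \o (fun y => F (x - y) * c)).
Proof.
have := L1Zl c (L1_kernel_snd x).
by apply: eq_integrable => // y _ /=; rewrite mulrC.
Qed.

Lemma L1_conv_measure : L1 (conv_measure F m).
Proof.
(* The constant weight 1 reduces the claim to the weighted product above. *)
have m1 : measurable_fun setT (cst 1 : R -> R) by exact: measurable_cst.
have c1 (x : R) : `|cst 1 x| <= 1 :> R by rewrite normr1.
have := @L1_fubini1 _ _ T T R mu m (fun x y => F (x - y) * cst 1 x)
  (kernel_mul_product_L1 m1 c1) (fun x => L1_kernel_snd_mul x 1).
apply: eq_integrable => // x _ /=; congr (_%:E); apply: eq_Rintegral => y _.
by rewrite mulr1.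
Qed.

(** Fubini. It is used with [psi] a test function, to transfer weak derivatives, and with [psi] the
    difference of two convolutions, to expand the integral of its square. *)
Lemma conv_measure_duality (psi : R -> R) C : measurable_fun setT psi ->
  (forall x, `|psi x| <= C) ->
  \int[mu]_x (conv_measure F m x * psi x) =
  \int[m]_y (\int[mu]_x (F (x - y) * psi x)).
Proof.
move=> mpsi psiC.
rewrite -(@Rintegral_fubini _ _ T T R mu m (fun x y => F (x - y) * psi x)).
- by apply: eq_Rintegral => x _; rewrite RintegralZr//; exact: L1_kernel_snd.
- exact: (kernel_mul_product_L1 mpsi psiC).
- by move=> x; exact: L1_kernel_snd_mul.
- by move=> y; exact: L1_kernel_mul psiC.
Qed.

End finite_measure.

(** Tonelli with the integral in [y] inside, where a reflection gives [normF * |v x|]. Together with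
    the Lipschitz property, this integrability makes the correlation vanish at infinity. *)
Lemma L1_conv_L1 (v : R -> R) C : L1 v -> (forall x, `|v x| <= C) ->
  L1 (fun y => \int[mu]_x (F (x - y) * v x)).
Proof.
move=> lv vC; have mv := L1_measurable lv.
have lFv x : L1 (fun y => F (x - y) * v x).
  have := L1Zl (v x) (L1_reflect x lF).
  by apply: eq_integrable => // y _ /=; rewrite mulrC.
apply: (@L1_fubini2 _ _ T T R mu mu (fun x y => F (x - y) * v x)); last first.
  by move=> y; exact: L1_kernel_mul vC.
apply/integrable12ltyP; first by apply/measurable_EFinP; exact: measurable_kernel_mul.
have inner x : (\int[mu]_y `|(F (x - y) * v x)%:E| = (normF * `|v x|)%:E)%E.
  transitivity ((\int[mu]_y `|F (x - y) * v x|)%:E)%E.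
    rewrite /Rintegral fineK//.
    exact: (integrable_fin_num measurableT (L1_norm (lFv x))).
  congr (_%:E); under eq_Rintegral do rewrite normrM.
  rewrite RintegralZr//; last exact: L1_norm (L1_reflect x lF).
  by rewrite (@Rintegral_reflect _ x (fun y => `|F y|))//; exact: L1_norm.
under eq_integral do rewrite inner.
exact: (integrable_lty measurableT (L1Zl normF (L1_norm lv))).
Qed.

End convolution.

(** * Norm estimates for convolutions with measures *)

Section norm_convolution.
Context {R : realType}.
Local Notation mu := (@lebesgue_measure R).
Local Notation T := (measurableTypeR R).
Local Notation L1 f := (mu.-integrable setT (EFin \o f)).
Implicit Types (F v : R -> R) (B C : R).

(** Young's inequality for a measure of mass at most 1: |F * m| <= |F| * m pointwise, and the
    integral of the right-hand side follows by duality with the constant 1. *)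
Lemma Rintegral_conv_measure_norm F B (m : subprobability T R) :
  measurable_fun setT F -> (forall x, `|F x| <= B) -> L1 F ->
  \int[mu]_x `|conv_measure F m x| <= \int[mu]_x `|F x|.
Proof.
move=> mF FB lF; pose aF x : R := `|F x|.
have maF : measurable_fun setT aF by exact: measurableT_comp.
have aFB x : `|aF x| <= B by rewrite normr_id.
have laF : L1 aF by exact: L1_norm.
have m1 : measurable_fun setT (cst 1 : R -> R) by exact: measurable_cst.
have c1 (x : R) : `|cst 1 x| <= 1 :> R by rewrite normr1.
apply: (@le_trans _ _ (\int[mu]_x (conv_measure aF m x * cst 1 x))).
  apply: le_Rintegral => //.
  - exact: L1_norm (L1_conv_measure mF FB lF m).
  - have := L1_conv_measure maF aFB laF m.
    by apply: eq_integrable => // x _ /=; rewrite mulr1.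
  - move=> x _; rewrite mulr1.
    exact: (le_normr_Rintegral measurableT (L1_kernel_snd mF FB m x)).
rewrite (conv_measure_duality maF aFB laF m m1 c1).
apply: Rintegral_subprobability_le.
- by apply: Rintegral_ge0.
- exact: (@L1_fubini2 _ _ T T R mu m (fun x y => aF (x - y) * cst 1 x)
    (kernel_mul_product_L1 maF laF m m1 c1)
    (fun y => L1_kernel_mul laF y m1 c1)).
- move=> y; rewrite -(Rintegral_kernel_norm lF y).
  by under eq_Rintegral do rewrite mulr1.
Qed.

(* Satisfied both by Lipschitz kernels and by integrable kernels of bounded
   variation. *)
Definition translation_bounded C F := forall v b, L1 v -> (forall x, `|v x| <= b) ->
  forall y z, \int[mu]_x (`|F (x - y) - F (x - z)| * `|v x|) <=
    C * (b + \int[mu]_x `|v x|) * `|y - z|.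

(* [int (F*m1 - F*m2)^2 = int g d(m1 - m2)] where [g] is the correlation of [F]
   with [F*m1 - F*m2], a Lipschitz function of class [C0]. *)
Lemma conv_measure_sub_L2_le F B C (m1 m2 : subprobability T R) :
  measurable_fun setT F -> (forall x, `|F x| <= B) -> L1 F ->
  translation_bounded C F -> 0 <= C ->
  ((\int[mu]_x ((conv_measure F m1 x - conv_measure F m2 x) ^+ 2))%:E <=
   (2 * B * (\int[mu]_x `|F x|) + C * (2 * B + 2 * \int[mu]_x `|F x|) + 1)%:E *
   BL_dist m1 m2)%E.
Proof.
move=> mF FB lF FC C_ge0.
have B0 : 0 <= B by exact: le_trans (FB 0).
pose N := \int[mu]_x `|F x|.
have N0 : 0 <= N by exact: Rintegral_ge0.
pose u1 := conv_measure F m1; pose u2 := conv_measure F m2.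
have l1 : L1 u1 by exact: L1_conv_measure mF FB lF m1.
have l2 : L1 u2 by exact: L1_conv_measure mF FB lF m2.
pose v x := u1 x - u2 x; have lv : L1 v by exact: L1B.
have mv := L1_measurable lv.
have vB x : `|v x| <= 2 * B.
  apply: le_trans (ler_normB _ _) _.
  rewrite (_ : 2 * B = B + B); last by ring.
  by apply: lerD; exact: conv_measure_bounded.
have vN : \int[mu]_x `|v x| <= 2 * N.
  apply: (@le_trans _ _ (\int[mu]_x (`|u1 x| + `|u2 x|))).
    apply: le_Rintegral => //; first exact: L1_norm.
      by apply: L1D; exact: L1_norm.
    by move=> x _; exact: ler_normB.
  rewrite RintegralD//; [|exact: L1_norm|exact: L1_norm].
  rewrite (_ : 2 * N = N + N); last by ring.
  by apply: lerD; exact: Rintegral_conv_measure_norm.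
pose g y := \int[mu]_x (F (x - y) * v x).
have lFv y : L1 (fun x => F (x - y) * v x) by exact: L1_kernel_mul vB.
have gB y : `|g y| <= 2 * B * N.
  apply: le_trans (le_normr_Rintegral measurableT (lFv y)) _.
  exact: Rintegral_kernel_mul_le.
pose L := C * (2 * B + 2 * N).
have gL : lipschitz_with L g.
  move=> y z; rewrite /g -RintegralB//.
  apply: le_trans (le_normr_Rintegral measurableT (L1B (lFv y) (lFv z))) _.
  under eq_Rintegral do rewrite -mulrBl normrM.
  apply: le_trans (FC v _ lv vB y z) _.
  by rewrite ler_wpM2r// ler_wpM2l// lerD2l.
have gC0 : C0 g by exact: lipschitz_L1_C0 gL (L1_conv_L1 mF lF lv vB).
(* [2 * B * N] bounds [g], [L] is its Lipschitz constant, and the additional 1 keeps the scaling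
   factor positive. *)
have K0 : 0 < 2 * B * N + L + 1.
  by rewrite ltr_wpDl// addr_ge0// ?mulr_ge0// addr_ge0// mulr_ge0.
have le : 2 * B * N + L <= 2 * B * N + L + 1 by rewrite lerDl.
apply: le_trans (BL_dist_test m1 m2 gC0 gB gL K0 le).
rewrite lee_fin -(conv_measure_duality mF FB lF m1 mv vB).
rewrite -(conv_measure_duality mF FB lF m2 mv vB) -RintegralB//.
- by under [leRHS]eq_Rintegral do rewrite -mulrBl.
- have := @L1_Mbounded _ T R mu _ _ _ mv vB l1.
  by apply: eq_integrable => // x _ /=; rewrite mulrC.
- have := @L1_Mbounded _ T R mu _ _ _ mv vB l2.
  by apply: eq_integrable => // x _ /=; rewrite mulrC.
Qed.

End norm_convolution.

(** * Functions of bounded variation *)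

Section translation_bounds.
Context {R : realType}.
Local Notation mu := (@lebesgue_measure R).
Local Notation T := (measurableTypeR R).
Local Notation L1 f := (mu.-integrable setT (EFin \o f)).
Implicit Types (F V f v : R -> R) (B C M h x y z : R).

Lemma lipschitz_translation_bounded L F : lipschitz_with L F -> measurable_fun setT F ->
  translation_bounded L F.
Proof.
move=> FL mF v b lv vb y z; have L0 := lipschitz_with_ge0 FL.
have b0 : 0 <= b by exact: le_trans (vb 0).
have mv := L1_measurable lv.
have mtr c : measurable_fun setT (fun x : R => F (x - c)).
  by apply: measurableT_comp => //; exact: measurable_funB.
have le x : `|F (x - y) - F (x - z)| * `|v x| <= L * `|y - z| * `|v x|.
  rewrite ler_wpM2r// (le_trans (FL _ _))// (_ : x - y - (x - z) = z - y).
    by rewrite distrC.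
  by ring.
apply: (@le_trans _ _ (\int[mu]_x (L * `|y - z| * `|v x|))).
  apply: le_Rintegral => //; last exact/L1Zl/L1_norm.
  apply: (@L1_le _ T R mu _ (fun x => L * `|y - z| * `|v x|)).
  - apply: measurable_funM; last exact: measurableT_comp.
    by apply: measurableT_comp => //; apply: measurable_funB; exact: mtr.
  - by move=> x; rewrite ger0_norm ?mulr_ge0.
  - exact/L1Zl/L1_norm.
rewrite RintegralZl//; last exact: L1_norm.
by rewrite mulrAC ler_wpM2r// ler_wpM2l// lerDr.
Qed.

(** Dual to the Lipschitz case: the increments of [F] are measured in L^1 and [v] by its supremum
    bound [b]. A translation by [z] reduces the two arguments to the single increment [z - y]. *)
Lemma L1_lipschitz_translation_bounded C F : 0 <= C -> L1 F ->
  (forall h, \int[mu]_x `|F (x + h) - F x| <= C * `|h|) ->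
  translation_bounded C F.
Proof.
move=> C0 lF FC v b lv vb y z.
have b0 : 0 <= b by exact: le_trans (vb 0).
have mv := L1_measurable lv; have mF := L1_measurable lF.
have lD : L1 (fun x => `|F (x - y) - F (x - z)|).
  by apply: L1_norm; apply: L1B; exact: L1_translate.
apply: (@le_trans _ _ (\int[mu]_x (b * `|F (x - y) - F (x - z)|))).
  apply: le_Rintegral => //; last 2 first.
  - exact: L1Zl.
  - by move=> x _; rewrite mulrC ler_wpM2r.
  apply: (@L1_le _ T R mu _ (fun x => b * `|F (x - y) - F (x - z)|)).
  - apply: measurable_funM; first exact: L1_measurable lD.
    exact: measurableT_comp.
  - by move=> x; rewrite normrM !normr_id mulrC ler_wpM2r.
  - exact: L1Zl.
rewrite RintegralZl// -(Rintegral_translate z lD).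
under eq_Rintegral do rewrite addrK.
have -> : \int[mu]_x `|F (x + z - y) - F x| = \int[mu]_x `|F (x + (z - y)) - F x|.
  by apply: eq_Rintegral => x _; rewrite addrA.
apply: (@le_trans _ _ (b * (C * `|z - y|))); first by rewrite ler_wpM2l.
rewrite mulrA distrC ler_wpM2r// mulrC ler_wpM2l// lerDl.
exact: Rintegral_ge0.
Qed.

Lemma L1_indic_itv (a b : bool) x y :
  L1 (\1_[set` Interval (BSide a x) (BSide b y)] : R -> R).
Proof. exact: integrable_indic_itv. Qed.

(** The integral telescopes to that of [V] over [k, k + h] minus that over [-k, -k + h]; the first
    is at most M h and the second is nonnegative. The truncation is there because [V] itself need
    not be integrable. *)
Lemma monotone_increment_integral V M h k : nondecreasing_fun V ->
  (forall x, 0 <= V x <= M) -> 0 <= h -> 0 <= k ->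
  \int[mu]_x ((V (x + h) - V x) * \1_`[- k, k] x) <= M * h.
Proof.
move=> ndV VM h0 k0.
have mV : measurable_fun setT V by exact: nondecreasing_measurable.
have VB x : `|V x| <= M by have /andP[? ?] := VM x; rewrite ger0_norm.
have li1 : L1 (fun x => V x * \1_`[- k + h, k + h] x).
  exact: (@L1_Mbounded _ T R mu _ _ _ mV VB (L1_indic_itv true false (- k + h) (k + h))).
have li2 : L1 (fun x => V x * \1_`[- k, k] x).
  exact: (@L1_Mbounded _ T R mu _ _ _ mV VB (L1_indic_itv true false (- k) k)).
have li1' : L1 (fun x => V (x + h) * \1_`[- k, k] x).
  have := L1_translate h li1; apply: eq_integrable => // x _ /=.
  by rewrite !indicE !mem_setE !in_itv/= !lerD2r.
have -> : \int[mu]_x ((V (x + h) - V x) * \1_`[- k, k] x) =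
    \int[mu]_x (V x * \1_`[- k + h, k + h] x - V x * \1_`[- k, k] x).
  rewrite RintegralB// -(Rintegral_translate h li1).
  transitivity (\int[mu]_x (V (x + h) * \1_`[- k, k] x - V x * \1_`[- k, k] x)).
    by apply: eq_Rintegral => x _; rewrite mulrBl.
  rewrite RintegralB//; congr (_ - _).
  by apply: eq_Rintegral => x _; rewrite !indicE !mem_setE !in_itv/= !lerD2r.
apply: (@le_trans _ _ (\int[mu]_x (M * \1_`]k, k + h] x))).
  apply: le_Rintegral => //.
  - exact: L1B.
  - exact/L1Zl/L1_indic_itv.
  - move=> x _; have /andP[V0 Vx] := VM x.
    rewrite !indicE !mem_setE !in_itv/=.
    case: (lerP (- k + h) x) => ?; case: (lerP x (k + h)) => ?;
    case: (lerP (- k) x) => ?; case: (lerP x k) => ?;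
    rewrite /= ?mulr0 ?mulr1 ?subr0 ?sub0r ?subrr//; lra.
rewrite RintegralZl//; last exact: L1_indic_itv.
rewrite /Rintegral integral_indic// setIT/= lebesgue_measure_itv/= lte_fin.
have M0 : 0 <= M by have /andP[V0 V0M] := VM 0; exact: le_trans V0 V0M.
by case: ifP => _ /=; rewrite ?mulr0 ?mulr_ge0//; rewrite addrC addKr.
Qed.

(** The truncated bound does not depend on [k], so it passes to the limit by dominated convergence.
    A negative increment is reduced to a positive one by translation. *)
Lemma increment_dominated_L1_lipschitz F V M : L1 F -> nondecreasing_fun V ->
  (forall x, 0 <= V x <= M) ->
  (forall x y, x <= y -> `|F y - F x| <= V y - V x) ->
  forall h, \int[mu]_x `|F (x + h) - F x| <= M * `|h|.
Proof.
move=> lF ndV VM FV.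
suff pos h : 0 <= h -> \int[mu]_x `|F (x + h) - F x| <= M * `|h|.
  move=> h; have [/pos//|/ltW h0] := leP 0 h.
  have := pos (- h); rewrite oppr_ge0 normrN => /(_ h0); apply: le_trans.
  have lD : L1 (fun x => `|F (x + h) - F x|).
    by apply: L1_norm; apply: L1B => //; exact: L1_translate.
  rewrite -(Rintegral_translate (- h) lD).
  rewrite le_eqVlt; apply/orP; left; apply/eqP.
  by apply: eq_Rintegral => x _; rewrite subrK distrC.
move=> h0; rewrite (ger0_norm h0).
have mV : measurable_fun setT V by exact: nondecreasing_measurable.
have VB x : `|V x| <= M by have /andP[? ?] := VM x; rewrite ger0_norm.
have lD : L1 (fun x => `|F (x + h) - F x|).
  by apply: L1_norm; apply: L1B => //; exact: L1_translate.
have mD := L1_measurable lD.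
pose D_ (k : nat) x : R := `|F (x + h) - F x| * \1_`[- k%:R, k%:R] x.
have lD_ k : L1 (D_ k).
  apply: (@L1_le _ T R mu _ (fun x => `|F (x + h) - F x|)) => //.
    by apply: measurable_funM => //; exact: measurable_indic.
  move=> x; rewrite /D_ normrM normr_id ler_piMr// indicE.
  by case: (_ \in _); rewrite ?normr1 ?normr0.
have cD : \int[mu]_x D_ k x @[k --> \oo] --> \int[mu]_x `|F (x + h) - F x|.
  apply: (@Rintegral_cvg _ T R mu D_ _ (fun x => `|F (x + h) - F x|)) => //.
  - by move=> k; exact: L1_measurable (lD_ k).
  - apply: aeW => x; apply: cvg_near_cst; near=> k.
    rewrite /D_ indicE mem_set ?mulr1//= in_itv/= -ler_norml.
    by near: k; exact: nbhs_infty_ger.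
  - move=> k x; rewrite /D_ normrM normr_id ler_piMr// indicE.
    by case: (_ \in _); rewrite ?normr1 ?normr0.
rewrite -(cvg_lim _ cD)//; apply: limr_le; first exact: cvgP cD.
apply: nearW => k.
apply: le_trans (monotone_increment_integral ndV VM h0 (ler0n _ k)).
apply: le_Rintegral => //.
- rewrite (_ : (fun x => _) = fun x =>
      V (x + h) * \1_`[- k%:R, k%:R] x - V x * \1_`[- k%:R, k%:R] x); last first.
    by apply/funext => x; rewrite mulrBl.
  have mVh : measurable_fun setT (fun x => V (x + h)).
    by apply: measurableT_comp => //; exact: measurable_funD.
  have VhB x : `|V (x + h)| <= M by exact: VB.
  have lk := L1_indic_itv true false (- k%:R) k%:R.
  apply: L1B.
    exact: (@L1_Mbounded _ T R mu _ _ _ mVh VhB lk).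
  exact: (@L1_Mbounded _ T R mu _ _ _ mV VB lk).
- by move=> x _; rewrite /D_ ler_wpM2r// FV// lerDl.
Unshelve. all: by end_near. Qed.

Lemma BV_bounded F : BV F -> exists B : R, forall x, `|F x| <= B.
Proof.
move=> [_ [M FM]]; exists (`|F 0| + M) => x.
rewrite -[X in `|X|](subrK (F 0)) (le_trans (ler_normD _ _))// addrC lerD2l.
have [x0|/ltW x0] := leP 0 x.
  by rewrite -lee_fin; exact: le_trans (total_variation_ge _ x0) (FM _ _ x0).
by rewrite distrC -lee_fin; exact: le_trans (total_variation_ge _ x0) (FM _ _ x0).
Qed.

Lemma BV_translation_bounded F : BV F ->
  exists2 C : R, 0 <= C & translation_bounded C F.
Proof.
move=> [lF [M FM]].
have M0 : 0 <= M.
  by rewrite -lee_fin; exact: le_trans (total_variation_ge0 _ (lexx 0)) (FM _ _ (lexx 0)).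
exists M => //; apply: L1_lipschitz_translation_bounded => //.
pose tv a x := fine (total_variation a x F).
have tv_fin a x : a <= x -> total_variation a x F \is a fin_num.
  move=> ax; rewrite ge0_fin_numE; last exact: total_variation_ge0.
  exact: le_lt_trans (FM _ _ ax) (ltry _).
have tvM a x : a <= x -> 0 <= tv a x <= M.
  move=> ax; rewrite -!lee_fin /tv fineK ?tv_fin// FM// andbT.
  exact: total_variation_ge0.
(* The variation of [F] on the half-line up to [x]. Without a base point, [V] is nonnegative and
   bounded by [M] on the whole line, and by additivity of the variation its increments dominate
   those of [F]. *)
pose V x := sup [set tv a x | a in [set a | a <= x]].
have sV x : has_sup [set tv a x | a in [set a | a <= x]].
  split; first by exists (tv x x); exists x => /=.
  by exists M => _ [a /= ax <-]; have /andP[] := tvM _ _ ax.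
have VD x y : x <= y -> `|F y - F x| <= V y - V x.
  move=> xy; rewrite lerBrDr -lerBrDl; apply: ge_sup; first exact: (sV x).1.
  move=> _ [a /= ax <-]; rewrite lerBrDl.
  apply: (@le_trans _ _ (tv a y)); last first.
    by apply: (ub_le_sup (sV y).2); exists a => //=; exact: le_trans xy.
  rewrite -lee_fin EFinD /tv !fineK ?tv_fin//; last exact: le_trans xy.
  by rewrite (total_variationD F ax xy) addeC leeD2l// total_variation_ge.
apply: (increment_dominated_L1_lipschitz (V := V)) => //.
- by move=> x y xy; rewrite -subr_ge0; apply: le_trans (VD _ _ xy).
- move=> x; apply/andP; split.
    apply: (@le_trans _ _ (tv x x)); first by have /andP[] := tvM _ _ (lexx x).
    by apply: (ub_le_sup (sV x).2); exists x => /=.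
  apply: ge_sup; first exact: (sV x).1.
  by move=> _ [a /= ax <-]; have /andP[] := tvM _ _ ax.
Qed.

End translation_bounds.

(** * Sobolev norms *)

Section sobolev_norm.
Context {R : realType}.
Local Notation mu := (@lebesgue_measure R).
Local Notation T := (measurableTypeR R).
Local Notation L1 f := (mu.-integrable setT (EFin \o f)).
Implicit Types (f g phi : R -> R) (w : nat -> R -> R).

Lemma Lfun2P f : f \in Lfun mu 2%:E <->
  measurable_fun setT f /\ L1 (fun x => f x ^+ 2).
Proof.
split=> [f2|[mf lf]].
  split; last exact: Lfun2_integrable_sqr.
  by move: f2; rewrite inE => /andP[]; rewrite inE.
rewrite inE; apply/andP; split; rewrite inE//= /finite_norm unlock.
apply: poweR_lty.
under eq_integral do rewrite /= powR_mulrn// -normrX ger0_norm ?sqr_ge0//.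
exact: (integrable_lty measurableT lf).
Qed.

Lemma Rintegral_ae_eq f g : measurable_fun setT f -> measurable_fun setT g ->
  {ae mu, forall x, f x = g x} -> \int[mu]_x f x = \int[mu]_x g x.
Proof.
move=> mf mg fg; rewrite /Rintegral; congr fine.
apply: ae_eq_integral => //; [exact/measurable_EFinP|exact/measurable_EFinP|].
by apply: ae_imply fg => x /= -> _.
Qed.

(** The representatives of order 0 agree almost everywhere, both being equal to [f]. Hence [w k] and
    [w' k] have the same integrals against test functions, and the fundamental lemma applies to
    their difference. *)
Lemma weak_derivatives_unique n f w w' : weak_derivatives n f w ->
  weak_derivatives n f w' ->
  forall k, (k <= n)%N -> {ae mu, forall x, w k x = w' k x}.
Proof.
move=> [fw wP] [fw' wP'] k kn.
have w00' : {ae mu, forall x, w 0%N x = w' 0%N x}.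
  apply: ae_imply (ae_and fw fw') => x [fwx fwx'].
  by rewrite -fwx// -fwx'.
have [/Lfun2P[m0 _] _] := wP 0%N isT; have [/Lfun2P[m0' _] _] := wP' 0%N isT.
have [/Lfun2P[mk lk] wk] := wP k kn; have [/Lfun2P[mk' lk'] wk'] := wP' k kn.
suff : {ae mu, forall x, w k x - w' k x = 0}.
  by apply: ae_imply => x /eqP; rewrite subr_eq0 => /eqP.
have lprod (g1 g2 : R -> R) : measurable_fun setT g1 -> measurable_fun setT g2 ->
    L1 (fun x => g1 x ^+ 2) -> L1 (fun x => g2 x ^+ 2) -> L1 (fun x => g1 x * g2 x).
  exact: (@L1_Msquare _ T R mu).
apply: fundamental_lemma; first exact: measurable_funB.
  exact: (@L1_sqrB _ T R mu).
move=> phi tphi.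
have mphi := test_function_measurable tphi; have lphi := test_function_sqr_L1 tphi.
rewrite (_ : \int[mu]_x _ = \int[mu]_x (w k x * phi x - w' k x * phi x)); last first.
  by apply: eq_Rintegral => x _; rewrite mulrBl.
rewrite RintegralB//; [|exact: lprod|exact: lprod].
apply/eqP; rewrite subr_eq0; apply/eqP.
apply: (@mulfI _ ((-1) ^+ k)); first by rewrite expf_neq0// oppr_eq0 oner_neq0.
rewrite -wk// -wk'//; apply: Rintegral_ae_eq.
- apply: measurable_funM => //.
  exact: test_function_measurable (test_function_derive1n k tphi).
- apply: measurable_funM => //.
  exact: test_function_measurable (test_function_derive1n k tphi).
- by apply: ae_imply w00' => x ->.
Qed.

(** Removes the choice made in [weak_der]: any explicit family of weak derivatives computes the
    norm. *)
Lemma Hn_normE n f w : weak_derivatives n f w ->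
  Hn_norm n f = Num.sqrt (\sum_(k < n.+1) \int[mu]_x (w k x ^+ 2)).
Proof.
move=> wP; have wP' : weak_derivatives n f (weak_der n f) := xgetPex _ (ex_intro _ w wP).
rewrite /Hn_norm; congr Num.sqrt; apply: eq_bigr => k _.
have kn : (k <= n)%N by rewrite -ltnS.
have [/Lfun2P[mk _] _] := wP.2 k kn; have [/Lfun2P[mk' _] _] := wP'.2 k kn.
apply: Rintegral_ae_eq; [exact: measurable_funX|exact: measurable_funX|].
by apply: ae_imply (weak_derivatives_unique wP' wP kn) => x ->.
Qed.

End sobolev_norm.

(** * Kernels defined almost everywhere *)

Section integral_off_null_set.
Context d (X : measurableType d) (R : realType) (m : {measure set X -> \bar R}).
Implicit Types (N : set X).
Import HBNNSimple.

(* [f] and [g] need not be measurable: the integral is then a lower one. *)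
Lemma le_integral_off_null N (f g : X -> \bar R) : measurable N -> m N = 0%E ->
  (forall x, 0 <= f x)%E -> (forall x, 0 <= g x)%E ->
  (forall x, ~ N x -> f x <= g x)%E -> (\int[m]_x f x <= \int[m]_x g x)%E.
Proof.
move=> mN N0 f0 g0 fg; rewrite !ge0_integralTE//.
apply: ge_ereal_sup => _ /= [h hf <-].
have mNC : measurable (setT `\` N) by exact: measurableD.
(* Setting the simple function to 0 on [N] puts it below the nonnegative [g] everywhere and leaves
   its integral unchanged. *)
apply: ereal_sup_ubound; exists (proj_nnsfun h mNC) => /=.
  move=> x; rewrite mindicE; case: (boolP (x \in _)) => [|_].
    by rewrite inE => -[_ Nx]; rewrite mulr1 (le_trans (hf x))// fg.
  by rewrite mulr0.
rewrite -mrestrict -integral_nnsfun// -ge0_negligible_integral//.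
- by rewrite integral_nnsfun// patch_setT.
- exact/measurable_EFinP.
- by move=> x _; rewrite lee_fin; exact: fun_ge0.
Qed.

Lemma Rintegral_eq_off_null N (f g : X -> R) : measurable N -> m N = 0%E ->
  (forall x, ~ N x -> f x = g x) -> \int[m]_x f x = \int[m]_x g x.
Proof.
move=> mN N0 fg; rewrite /Rintegral; congr fine.
rewrite integralE [RHS]integralE; congr (_ - _)%E; apply/eqP; rewrite eq_le;
  by apply/andP; split; apply: (le_integral_off_null mN N0) => // x /fg fgx;
    rewrite ?funeposE ?funenegE fgx.
Qed.

End integral_off_null_set.

Section convolution_ae.
Context {R : realType}.
Local Notation mu := (@lebesgue_measure R).
Local Notation T := (measurableTypeR R).

(** Tonelli for the indicator of the pairs with x - y in [N]: by translation invariance the integral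
    in [x] is 0 for every [y], so the one in [y] is 0 for almost every [x]. *)
Lemma ae_translate_null (N : set R) (m : subprobability T R) : measurable N ->
  mu N = 0%E -> {ae mu, forall x, m [set y | N (x - y)] = 0%E}.
Proof.
move=> mN N0.
pose f (z : T * T) : \bar R := (\1_N (z.1 - z.2))%:E.
have mf : measurable_fun setT f.
  apply/measurable_EFinP.
  have mI : measurable_fun setT (\1_N : R -> R) by exact: measurable_indic.
  exact: measurable_conv_kernel mI.
have f0 z : (0 <= f z)%E by rewrite lee_fin.
have := @fubini_tonelli _ _ T T R mu m f mf f0.
have secE x : (\int[m]_y f (x, y) = m [set y | N (x - y)%R])%E.
  rewrite /f /= (_ : (fun y => _) = fun y => (\1_[set y | N (x - y)] y)%:E).
    rewrite integral_indic ?setIT//.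
    have := measurable_reflect x measurableT mN; rewrite setTI; exact.
  by apply/funext => y; rewrite !indicE; congr (_%:R%:E); apply/idP/idP;
    rewrite !inE.
have G0 y : (\int[mu]_x f (x, y) = 0)%E.
  rewrite /f /=.
  have mI : measurable_fun setT (fun x : R => (\1_N x)%:E : \bar R).
    by apply/measurable_EFinP; exact: measurable_indic.
  have mIy : measurable_fun setT (fun x : R => (\1_N (x - y))%:E : \bar R).
    apply/measurable_EFinP; apply: measurableT_comp; first exact: measurable_indic.
    exact: measurable_funB.
  have I0 (z : R) : (0 <= (\1_N z)%:E :> \bar R)%E by rewrite lee_fin.
  rewrite -(ge0_integral_reflect 0 mIy (fun x => I0 (x - y))).
  under eq_integral do rewrite sub0r addrC.
  rewrite (ge0_integral_reflect (- y) mI I0).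
  by rewrite integral_indic// setIT.
have -> : (\int[m]_y fubini_G mu f y = 0)%E.
  by rewrite /fubini_G; under eq_integral do rewrite G0; exact: integral0.
move=> F0; pose H x := (\int[m]_y f (x, y))%E.
have mH : measurable_fun setT H by exact: measurable_fun_fubini_tonelli_F.
have : ae_eq mu setT H (cst 0%E).
  apply/(ae_eq_integral_abs mu measurableT mH).
  rewrite -[RHS]F0; apply: eq_integral => x _; rewrite gee0_abs//.
  exact: integral_ge0.
by apply: ae_imply => x /(_ I); rewrite /H secE.
Qed.

(** For almost every [x] the two integrands differ only on an [m]-null set. Neither is assumed
    measurable, hence the comparison off a null set. *)
Lemma conv_measure_ae_eq (G F : R -> R) (m : subprobability T R) :
  {ae mu, forall x, G x = F x} ->
  {ae mu, forall x, conv_measure G m x = conv_measure F m x}.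
Proof.
move=> [N [mN N0 GFN]].
apply: ae_imply (ae_translate_null m mN N0) => x Nx.
apply: (@Rintegral_eq_off_null _ T R m [set y | N (x - y)]) => //.
  by have := measurable_reflect x measurableT mN; rewrite setTI; exact.
by move=> y Ny; apply: contrapT => GF; apply: Ny; apply: GFN.
Qed.

End convolution_ae.

(** * Derivatives of the kernel *)

Section kernel_derivatives.
Context {R : realType}.
Local Notation mu := (@lebesgue_measure R).
Local Notation T := (measurableTypeR R).
Local Notation L1 f := (mu.-integrable setT (EFin \o f)).
Implicit Types (f g phi : R -> R).

(** What the L^2 estimate on differences of convolutions asks of a kernel, whether Lipschitz or of
    bounded variation. *)
Definition good_kernel f := [/\ L1 f, exists B : R, forall x, `|f x| <= B &
  exists2 C : R, 0 <= C & translation_bounded C f].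

Lemma lipschitz_good_kernel L f : L1 f -> lipschitz_with L f -> good_kernel f.
Proof.
move=> lf fL; split => //; first by exists (\int[mu]_x `|f x| + L);
  exact: lipschitz_L1_bounded.
exists L; first exact: lipschitz_with_ge0 fL.
exact: lipschitz_translation_bounded fL (L1_measurable lf).
Qed.

Lemma BV_good_kernel f : BV f -> good_kernel f.
Proof.
by move=> BVf; split; [case: BVf|exact: BV_bounded|exact: BV_translation_bounded].
Qed.

(* [K 0], ..., [K n] is a representative of [(G, G', ..., G^(n))]. *)
Definition derivative_chain n (K : nat -> R -> R) :=
  (forall k, (k <= n)%N -> good_kernel (K k)) /\
  forall k, (k < n)%N -> (exists L : R, lipschitz_with L (K k)) /\
    {ae mu, forall x, derivable (K k) x 1 /\ (K k)^`() x = K k.+1 x}.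

Lemma regular_kernel_chain n G : regular_kernel n G ->
  exists2 K, derivative_chain n K & {ae mu, forall x, G x = K 0%N x}.
Proof.
move=> [Greg [F BVF GF]].
pose K k := if (k < n)%N then G^`(k) else F.
have Kd k : (k < n)%N ->
    {ae mu, forall x, derivable (K k) x 1 /\ (K k)^`() x = K k.+1 x}.
  move=> kn; rewrite /K kn; case: ltnP => [k1n|nk1].
    by apply: aeW => x; split => //; have [/(_ x) dG _ _] := Greg _ k1n; exact: dG.
  have nE : n = k.+1 by apply/eqP; rewrite eqn_leq nk1 kn.
  apply: ae_imply GF => x [dG GFx]; split; first by apply: dG; rewrite nE.
  by rewrite -GFx nE.
(* Downward induction from order [n]: the bound [B] of one derivative is the Lipschitz constant of
   the preceding one. At [j = 0] only bounded variation is available, hence the guard on the second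
   conjunct. *)
have Kgood j : (j <= n)%N -> good_kernel (K (n - j)%N) /\
    ((0 < j)%N -> exists L, lipschitz_with L (K (n - j)%N)).
  elim: j => [_|j IH jn].
    by split => //; rewrite subn0 /K ltnn; exact: BV_good_kernel.
  have [[_ [B KB] _] _] := IH (ltnW jn).
  have njn : (n - j.+1 < n)%N by rewrite ltn_subrL/= (leq_ltn_trans _ jn).
  have nj : (n - j.+1).+1 = (n - j)%N by rewrite -subSn.
  have [dG AC lG] := Greg _ njn.
  have KL : exists L, lipschitz_with L (K (n - j.+1)%N).
    exists B.
    have B0 : 0 <= B by exact: le_trans (KB 0).
    have le a b : a <= b -> `|K (n - j.+1)%N b - K (n - j.+1)%N a| <= B * (b - a).
      apply: AC_ae_derive_bounded_lipschitz => //; first by rewrite /K njn.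
      by apply: ae_imply (Kd _ njn) => x [? ->]; split => //; rewrite nj.
    move=> x y; have [xy|/ltW yx] := leP x y.
      by rewrite distrC (distrC x) (ger0_norm (_ : 0 <= y - x)) ?subr_ge0//; exact: le.
    by rewrite (ger0_norm (_ : 0 <= x - y)) ?subr_ge0//; exact: le.
  split => //; have [L KL'] := KL; apply: lipschitz_good_kernel KL'.
  by rewrite /K njn.
exists K.
  split=> [k kn|k kn].
    by have [] := Kgood _ (leq_subr k n); rewrite subKn.
  split; last exact: Kd.
  have [_] := Kgood _ (leq_subr k n); rewrite subKn ?(ltnW kn)//.
  by apply; rewrite subn_gt0.
(* For [n = 0] the chain is reduced to [F], which equals [G] only almost everywhere; otherwise it
   starts with [G] itself. *)
rewrite /K; case: n => [|n] in Greg GF K Kd Kgood *.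
  by apply: ae_imply GF => x [_].
by apply: aeW.
Qed.

Section chain.
Variables (n : nat) (K : nat -> R -> R).
Hypothesis Kchain : derivative_chain n K.

Let KL1 k : (k <= n)%N -> L1 (K k).
Proof. by case: Kchain => Kgood _ /Kgood[]. Qed.

Let Kmeas k : (k <= n)%N -> measurable_fun setT (K k).
Proof. by move=> kn; exact: L1_measurable (KL1 kn). Qed.

Lemma chain_integration_by_parts k phi : (k <= n)%N -> test_function phi ->
  \int[mu]_x (K 0%N x * phi^`(k)%classic x) =
  (-1) ^+ k * \int[mu]_x (K k x * phi x).
Proof.
elim: k phi => [|k IH] phi kn tphi; first by rewrite expr0 mul1r.
have [[L KL] KK] := Kchain.2 k kn.
rewrite derive1Sn IH ?(ltnW kn)//; last exact: test_function_derive1.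
rewrite (lipschitz_integration_by_parts KL (KL1 (ltnW kn)) (Kmeas kn) KK tphi).
by rewrite mulrN exprS mulN1r mulNr.
Qed.

(** Duality turns both sides into integrals against [m]. For each [y], a translation moves the shift
    from the kernel to the test function, and integration by parts for the chain applies to [phi]
    shifted by [y]. *)
Lemma conv_weak_derivative (m : subprobability T R) k : (k <= n)%N ->
  weak_derivative k (conv_measure (K 0%N) m) (conv_measure (K k) m).
Proof.
move=> kn phi tphi.
have [l0 [B0 KB0] _] := Kchain.1 0%N isT; have [lk [Bk KBk] _] := Kchain.1 k kn.
have tphik := test_function_derive1n k tphi.
have [C phiC] := test_function_bounded tphi.
have [Ck phikC] := test_function_bounded tphik.
have mphi := test_function_measurable tphi.
have mphik := test_function_measurable tphik.
rewrite (conv_measure_duality (Kmeas (leq0n n)) KB0 l0 m mphik phikC).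
rewrite (conv_measure_duality (Kmeas kn) KBk lk m mphi phiC).
transitivity (\int[m]_y ((-1) ^+ k * \int[mu]_x (K k (x - y) * phi x))).
  apply: eq_Rintegral => y _.
  rewrite -(Rintegral_translate y (L1_kernel_mul l0 y mphik phikC)).
  rewrite -(Rintegral_translate y (L1_kernel_mul lk y mphi phiC)).
  under eq_Rintegral do rewrite addrK.
  under [in RHS]eq_Rintegral do rewrite addrK.
  rewrite -(chain_integration_by_parts kn (test_function_shift y tphi)).
  apply: eq_Rintegral => x _; congr (_ * _).
  have sphi := test_function_smooth tphi.
  have := @derive1n_affine _ phi 1 y k (fun j x _ => sphi j x).
  under eq_fun do rewrite mul1r; move=> ->.
  by rewrite /= expr1n !mul1r.
rewrite RintegralZl//.
exact: (@L1_fubini2 _ _ T T R mu m (fun x y => K k (x - y) * phi x)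
  (kernel_mul_product_L1 (Kmeas kn) lk m mphi phiC)
  (fun y => L1_kernel_mul lk y mphi phiC)).
Qed.

Lemma conv_Lfun2 (m : subprobability T R) k : (k <= n)%N ->
  conv_measure (K k) m \in Lfun mu 2%:E.
Proof.
move=> kn; have [lk [B KB] _] := Kchain.1 k kn.
have lc := L1_conv_measure (Kmeas kn) KB lk m.
apply/Lfun2P; split; first exact: L1_measurable lc.
exact: (@L1_Mbounded _ T R mu _ _ _ (L1_measurable lc)
  (conv_measure_bounded (Kmeas kn) KB m) lc).
Qed.

Lemma conv_weak_derivatives (m : subprobability T R) f :
  {ae mu, forall x, f x = conv_measure (K 0%N) m x} ->
  weak_derivatives n f (fun k => conv_measure (K k) m).
Proof.
move=> fK; split; first by apply: ae_imply fK.
by move=> k kn; split; [exact: conv_Lfun2|exact: conv_weak_derivative].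
Qed.

Lemma conv_sub_weak_derivatives (m1 m2 : subprobability T R) f :
  {ae mu, forall x, f x = conv_measure (K 0%N) m1 x - conv_measure (K 0%N) m2 x} ->
  weak_derivatives n f (fun k x => conv_measure (K k) m1 x - conv_measure (K k) m2 x).
Proof.
move=> fK; split; first by apply: ae_imply fK.
move=> k kn; split.
  have /Lfun2P[mc1 lc1] := conv_Lfun2 m1 kn.
  have /Lfun2P[mc2 lc2] := conv_Lfun2 m2 kn.
  apply/Lfun2P; split; first exact: measurable_funB.
  exact: (@L1_sqrB _ T R mu).
have lprod (m : subprobability T R) j phi : (j <= n)%N -> test_function phi ->
    L1 (fun x => conv_measure (K j) m x * phi x).
  move=> jn tphi; have /Lfun2P[mc lc] := conv_Lfun2 m jn.
  apply: (@L1_Msquare _ T R mu) => //; first exact: test_function_measurable.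
  exact: test_function_sqr_L1.
move=> phi tphi; have tphik := test_function_derive1n k tphi.
under eq_Rintegral do rewrite mulrBl.
under [in RHS]eq_Rintegral do rewrite mulrBl.
rewrite !RintegralB//; try exact: lprod.
by rewrite mulrBr !conv_weak_derivative.
Qed.

(** The integral of a square is at most the supremum times the L^1 norm, and both are bounded by
    those of the kernel. *)
Lemma Hn_norm_conv_bounded G : {ae mu, forall x, G x = K 0%N x} ->
  exists M : R, forall m : subprobability T R, Hn_norm n (conv_measure G m) <= M.
Proof.
move=> GK.
have bound (k : 'I_n.+1) : exists b : R, forall m : subprobability T R,
    \int[mu]_x (conv_measure (K k) m x ^+ 2) <= b.
  have kn : (k <= n)%N by rewrite -ltnS.
  have [lk [B KB] _] := Kchain.1 k kn.
  have B0 : 0 <= B by exact: le_trans (KB 0).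
  exists (B * \int[mu]_x `|K k x|) => m.
  have lc := L1_conv_measure (Kmeas kn) KB lk m.
  have /Lfun2P[_ lc2] := conv_Lfun2 m kn.
  apply: (@le_trans _ _ (\int[mu]_x (B * `|conv_measure (K k) m x|))).
    apply: le_Rintegral => //; first exact/L1Zl/L1_norm.
    move=> x _; rewrite -real_normK ?num_real// expr2 ler_wpM2r//.
    exact: (conv_measure_bounded (Kmeas kn) KB m x).
  rewrite RintegralZl//; last exact: L1_norm.
  rewrite ler_wpM2l//.
  exact: (Rintegral_conv_measure_norm m (Kmeas kn) KB lk).
have /choice[b bP] := bound.
exists (Num.sqrt (\sum_(k < n.+1) b k)) => m.
rewrite (Hn_normE (conv_weak_derivatives (conv_measure_ae_eq m GK))).
by apply: ler_wsqrtr; apply: ler_sum => k _; exact: bP.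
Qed.

Lemma Hn_norm_conv_sub_le G : {ae mu, forall x, G x = K 0%N x} ->
  exists2 C : R, 0 <= C & forall m1 m2 : subprobability T R,
    ((Hn_norm n (conv_measure G m1 \- conv_measure G m2) ^+ 2)%:E <=
     C%:E * BL_dist m1 m2)%E.
Proof.
move=> GK.
have bound (k : 'I_n.+1) : exists b : R, 0 <= b /\ forall m1 m2 : subprobability T R,
    ((\int[mu]_x ((conv_measure (K k) m1 x - conv_measure (K k) m2 x) ^+ 2))%:E <=
     b%:E * BL_dist m1 m2)%E.
  have kn : (k <= n)%N by rewrite -ltnS.
  have [lk [B KB] [C C0 KC]] := Kchain.1 k kn.
  have B0 : 0 <= B by exact: le_trans (KB 0).
  have N0 : 0 <= \int[mu]_x `|K k x| by exact: Rintegral_ge0.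
  exists (2 * B * (\int[mu]_x `|K k x|) + C * (2 * B + 2 * \int[mu]_x `|K k x|) + 1).
  split; first by rewrite !addr_ge0 ?mulr_ge0 ?addr_ge0 ?mulr_ge0.
  by move=> m1 m2; exact: (conv_measure_sub_L2_le m1 m2 (Kmeas kn) KB lk KC C0).
have /choice[b bP] := bound.
exists (\sum_(k < n.+1) b k) => [|m1 m2].
  by apply: sumr_ge0 => k _; exact: (bP k).1.
have fK : {ae mu, forall x, (conv_measure G m1 \- conv_measure G m2) x =
    conv_measure (K 0%N) m1 x - conv_measure (K 0%N) m2 x}.
  apply: ae_imply (ae_and (conv_measure_ae_eq m1 GK) (conv_measure_ae_eq m2 GK)).
  by move=> x [<- <-].
rewrite (Hn_normE (conv_sub_weak_derivatives fK)).
rewrite sqr_sqrtr; last first.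
  by apply: sumr_ge0 => k _; apply: Rintegral_ge0 => x _; exact: sqr_ge0.
rewrite -!sumEFin ge0_sume_distrl; last by move=> k _; rewrite lee_fin (bP k).1.
by apply: lee_sum => k _; exact: (bP k).2.
Qed.

End chain.

End kernel_derivatives.

Theorem proposition4p4 (R : realType) (n : nat) (G : R -> R)
    (G_even : even_fun G) (G_regular : regular_kernel n G)
    (m : R -> subprobability (measurableTypeR R) R)
    (m_cont : BL_continuous m) :
  let u : R -> R -> R := fun t => conv_measure G (m t) in
  Cb_Hn n u /\ (BL_lipschitz m -> Cb_holder_half_Hn n u).
Proof.
move=> u; have [K Kchain GK] := regular_kernel_chain G_regular.
have uHn t : Hn n (u t).
  by exists (fun k => conv_measure (K k) (m t));
    apply: conv_weak_derivatives => //; exact: conv_measure_ae_eq.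
have ubd : Hn_bounded n u.
  have [M uM] := Hn_norm_conv_bounded Kchain GK.
  by exists M => t _; exact: uM.
have [C C0 uC] := Hn_norm_conv_sub_le Kchain GK.
have Hn0 (f : R -> R) : 0 <= Hn_norm n f by exact: sqrtr_ge0.
split; first split => //.
(* The distance is an extended real; its convergence to 0 makes it finite near [t], which permits
   real arithmetic. *)
- move=> t t0; have /fine_cvgP[fin cv] := m_cont t t0.
  apply/cvgr0Pnorm_lt => e e0.
  (* The square of the norm has to fall below [e ^+ 2]; dividing by [C + 1] allows [C = 0]. *)
  have d0 : 0 < e ^+ 2 / (C + 1) by rewrite divr_gt0 ?exprn_gt0// ltr_wpDl.
  have /cvgr0Pnorm_lt/(_ _ d0) cv0 := cv.
  apply: filterS2 fin cv0 => s sfin sd.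
  rewrite (ger0_norm (Hn0 _)) -ltr_sqr ?nnegrE ?Hn0 ?(ltW e0)//.
  rewrite -lte_fin; apply: le_lt_trans (uC _ _) _.
  rewrite -(fineK sfin) -EFinM lte_fin.
  apply: (@le_lt_trans _ _ ((C + 1) * `|fine (BL_dist (m s) (m t))|)).
    by rewrite (le_trans (ler_wpM2l C0 (ler_norm _)))// ler_wpM2r// lerDl.
  by rewrite mulrC -ltr_pdivlMr// ltr_wpDl.
- move=> [L L0 mL]; split => //.
  (* The squared norm is at most [C] times the distance, hence at most [C * L * |s - t|], of which
     the square root is taken. *)
  exists (Num.sqrt (C * L)) => s t s0 t0.
  rewrite powR12_sqrt// -sqrtrM ?mulr_ge0 ?(ltW L0)//.
  rewrite -ler_sqr ?nnegrE ?sqrtr_ge0//.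
  have CLst : 0 <= C * L * `|s - t| by rewrite !mulr_ge0// ltW.
  rewrite (sqr_sqrtr CLst) -lee_fin.
  apply: le_trans (uC _ _) _.
  by rewrite -mulrA EFinM lee_wpmul2l ?lee_fin// mL.
Qed.
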